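(* Let $0<s\le1$ and let $f(z)=z+\sum_{n=2}^{\infty}a_nz^n$ belong to the class $\mathcal{CV}_{hpl}(s)$. Then $$|a_n|\le\frac{(s)_{n-1}}{n!}\qquad(n=2,3,4,\dots).$$
   Context: Let $\mathbb{D}=\{z\in\mathbb{C}:|z|<1\}$, and let $\mathcal{S}$ be the class of functions $f(z)=z+\sum_{n\ge2}a_nz^n$ that are holomorphic and univalent in $\mathbb{D}$. For $0<s\le1$ put $\mathfrak{q}_s(z)=(1-z)^{-s}=e^{-s\ln(1-z)}$, $z\in\mathbb{D}$, with the branch of the logarithm such that $\mathfrak{q}_s(0)=1$. For holomorphic functions $p,F$ in $\mathbb{D}$, $p\prec F$ (subordination) means that there is a holomorphic $\omega:\mathbb{D}\to\mathbb{D}$ with $\omega(0)=0$ and $p(z)=F(\omega(z))$ for all $z\in\mathbb{D}$. The class $\mathcal{CV}_{hpl}(s)$ consists of all $f\in\mathcal{S}$ with $1+\frac{zf''(z)}{f'(z)}\prec\mathfrak{q}_s(z)$ in $\mathbb{D}$. The Pochhammer symbol is $(a)_n=\Gamma(a+n)/\Gamma(a)=a(a+1)\cdots(a+n-1)$. *)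

(* Defs.v *)
From Stdlib Require Import Reals Lra.
From Coquelicot Require Import Coquelicot.
Local Open Scope R_scope.

Definition in_disk (z : C) : Prop := Cmod z < 1.

Definition holomorphic_disk (f : C -> C) : Prop :=
  forall z : C, in_disk z -> @ex_derive C_AbsRing C_NormedModule f z.

Definition univalent_disk (f : C -> C) : Prop :=
  forall z w : C, in_disk z -> in_disk w -> f z = f w -> z = w.

(* f(z) = z + sum_{n >= 2} a_n z^n on the disk, with the coefficients indexed
   from 0, so that a_0 = 0 and a_1 = 1. *)
Definition normalized_expansion (f : C -> C) (a : nat -> C) : Prop :=
  a 0%nat = RtoC 0 /\ a 1%nat = RtoC 1 /\
  forall z : C, in_disk z -> @is_pseries C_AbsRing C_NormedModule a z (f z).

Definition class_S (f : C -> C) : Prop :=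
  holomorphic_disk f /\ univalent_disk f /\
  exists a : nat -> C, normalized_expansion f a.

Definition subordinate (p F : C -> C) : Prop :=
  exists omega : C -> C,
    holomorphic_disk omega /\
    (forall z : C, in_disk z -> in_disk (omega z)) /\
    omega (RtoC 0) = RtoC 0 /\
    (forall z : C, in_disk z -> p z = F (omega z)).

Definition Cexp (z : C) : C :=
  (exp (Re z) * cos (Im z), exp (Re z) * sin (Im z)).

(* Principal logarithm on the half-plane 0 < Re w, which contains 1 - z for
   every z in the disk; there the argument of w is atan (Im w / Re w).  The
   values outside this half-plane are meaningless. *)
Definition Clog_rhp (w : C) : C := (ln (Cmod w), atan (Im w / Re w)).

Lemma Cexp_Clog_rhp (w : C) : 0 < Re w -> Cexp (Clog_rhp w) = w.
Proof.
destruct w as [x y]; unfold Cexp, Clog_rhp, Cmod; simpl; intros Hx.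
replace (x * (x * 1) + y * (y * 1)) with (x² * (1 + (y / x)²))
  by (unfold Rsqr; field; lra).
assert (Hy : 0 < 1 + (y / x)²) by (pose proof (Rle_0_sqr (y / x)); lra).
rewrite sqrt_mult_alt by apply Rle_0_sqr.
rewrite sqrt_Rsqr by lra.
pose proof (sqrt_lt_R0 _ Hy) as Hs.
rewrite exp_ln by (apply Rmult_lt_0_compat; assumption).
rewrite cos_atan, sin_atan.
f_equal; field; lra.
Qed.

Lemma Clog_rhp_1 : Clog_rhp (RtoC 1) = RtoC 0.
Proof.
unfold Clog_rhp, RtoC at 3; rewrite Cmod_1, ln_1; simpl.
rewrite Rdiv_0_l, atan_0; reflexivity.
Qed.

Lemma Re_one_minus_disk (z : C) : in_disk z -> 0 < Re (1 - z).
Proof.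
unfold in_disk; intros Hz; pose proof (Rmax_Cmod z) as Hm.
pose proof (Rmax_l (Rabs (fst z)) (Rabs (snd z))).
pose proof (Rle_abs (fst z)).
destruct z as [x y]; simpl in *; lra.
Qed.

Definition frak_q (s : R) (z : C) : C :=
  Cexp (- RtoC s * Clog_rhp (1 - z))%C.

Lemma frak_q_0 (s : R) : frak_q s (RtoC 0) = RtoC 1.
Proof.
unfold frak_q; replace (1 - RtoC 0)%C with (RtoC 1) by ring.
rewrite Clog_rhp_1, Cmult_0_r; unfold Cexp; simpl.
rewrite exp_0, cos_0, sin_0; unfold RtoC; f_equal; ring.
Qed.

(* For f in class_S both complex derivatives exist on the disk and f' has no
   zero there, so the totalized C_derive and the quotient are the genuine ones. *)
Definition class_CV_hpl (s : R) (f : C -> C) : Prop :=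
  class_S f /\
  subordinate
    (fun z : C => (1 + z * C_derive (C_derive f) z / C_derive f z)%C)
    (frak_q s).

Fixpoint pochhammer (x : R) (n : nat) : R :=
  match n with
  | O => 1
  | S m => pochhammer x m * (x + INR m)
  end.

(* Main.v *)
Require Import Defs.
From Stdlib Require Import Reals Factorial Lra Lia Classical IndefiniteDescription.
From Coquelicot Require Import Coquelicot.
Local Open Scope R_scope.

(** Write [p = 1 + z f'' / f' = frak_q s o omega] and let [b i] be the
    coefficients of [p - 1].  Comparing coefficients in [(p - 1) f' = z f''],
    where [f'] has coefficients [c j = (j + 1) a (j + 1)], gives
    [k c k = c 0 b k + ... + c (k - 1) b 1] ([convexity_recursion]).  If
    [|b i| <= s] for all [i >= 1], induction on this recursion bounds [|c k|] by
    the solution [(s)_k / k!] of the same recursion with [b i = s]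
    ([coef_bound_of_recursion]), which is the claim.

    The bound [|b i| <= s] ([frak_q_coef_le]) is Rogosinski's inequality for the
    convex function [frak_q s], and it is proved by duality instead of convexity
    of the image.  Up to order [i] the function [p - 1] is the sum over [m >= 1]
    of [d m * omega ^ m] with [d m = (s)_m / m!] ([frak_q_taylor]).  For [|x| = 1]
    the function [(1 + x omega) / (1 - x omega)] has positive real part, so by
    Caratheodory's inequality ([caratheodory]) the [i]-th coefficients of the
    powers of [omega] are, up to a shift of the index, those of a polynomial
    bounded by [1] on the unit circle ([power_coefs_bound]).  For [s <= 1] the
    weights [d m], [m >= 1], are decreasing and convex, and against such weights
    the coefficients of a polynomial bounded by [1] sum to at most the first
    weight [d 1 = s]: sum by parts twice and use that Fejer means do not
    increase the maximum ([convex_weights_bound], [fejer_bound]).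

    All coefficients are means of [u z / z ^ k] over circles.  That these means
    do not depend on the radius ([is_cmean_radius]) is Cauchy's theorem for an
    annulus, which follows from Goursat's theorem for rectangles ([rect_int_0])
    in the coordinate [log z].  Goursat's bisection argument works from
    bare differentiability, which is what is known of [omega]; near the origin
    the power series of [f] is differentiated term by term ([expands_derive]). *)

(** * Complex derivatives *)

Notation is_cderive := (@is_derive C_AbsRing C_NormedModule).
Notation ex_cderive := (@ex_derive C_AbsRing C_NormedModule).

(** Every estimate below is an estimate of moduli, so the filter in the
    definition of the derivative is traded for explicit radii. *)
Lemma is_cderive_eps (f : C -> C) (z l : C) :
  is_cderive f z l <->
  forall eps, 0 < eps -> exists delta, 0 < delta /\
    forall w, Cmod (w - z) < delta ->
      Cmod (f w - f z - l * (w - z)) <= eps * Cmod (w - z).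
Proof.
split.
- intros [_ H] eps he.
  destruct (H z (fun P hP => hP) (mkposreal eps he)) as [d hd].
  exists d; split; [apply cond_pos|]; intros w hw.
  replace (l * (w - z))%C with ((w - z) * l)%C by ring.
  apply (hd w hw).
- intros H; split; [apply (is_linear_scal_l (K := C_AbsRing) (V := C_NormedModule))|].
  intros x hx.
  rewrite <- (is_filter_lim_locally_unique (K := C_AbsRing) (V := AbsRing_NormedModule C_AbsRing) _ _ hx).
  intros [eps he]; destruct (H eps he) as [d [hd H']].
  exists (mkposreal d hd); intros w hw.
  specialize (H' w hw); replace (l * (w - z))%C with ((w - z) * l)%C in H' by ring.
  apply H'.
Qed.

Lemma is_cderive_ext_ball (f g : C -> C) (z l : C) (d : R) :
  0 < d -> (forall w, Cmod (w - z) < d -> f w = g w) ->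
  is_cderive f z l -> is_cderive g z l.
Proof.
intros hd he; apply is_derive_ext_loc.
exists (mkposreal d hd); intros w hw; apply he, hw.
Qed.

Lemma is_cderive_eq (f : C -> C) (z l l' : C) :
  is_cderive f z l -> l = l' -> is_cderive f z l'.
Proof. intros H <-; exact H. Qed.

Lemma is_cderive_plus (f g : C -> C) (z l m : C) :
  is_cderive f z l -> is_cderive g z m ->
  is_cderive (fun w => f w + g w)%C z (l + m)%C.
Proof. apply (is_derive_plus (K := C_AbsRing) (V := C_NormedModule)). Qed.

Lemma is_cderive_minus (f g : C -> C) (z l m : C) :
  is_cderive f z l -> is_cderive g z m ->
  is_cderive (fun w => f w - g w)%C z (l - m)%C.
Proof. apply (is_derive_minus (K := C_AbsRing) (V := C_NormedModule)). Qed.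

Lemma is_cderive_const (c z : C) : is_cderive (fun _ => c) z (RtoC 0).
Proof. apply (is_derive_const (K := C_AbsRing) (V := C_NormedModule)). Qed.

(** [C] carries two normed module structures over itself.  They have the same
    norm, hence the same derivatives, but rules for products and compositions
    are stated for one and [C_derive] for the other. *)
Lemma is_cderive_ring (f : C -> C) (z l : C) :
  is_cderive f z l <->
  @is_derive C_AbsRing (AbsRing_NormedModule C_AbsRing) f z l.
Proof.
split; intros [_ H]; split; try exact H.
- apply (is_linear_scal_l (K := C_AbsRing) (V := AbsRing_NormedModule C_AbsRing)).
- apply (is_linear_scal_l (K := C_AbsRing) (V := C_NormedModule)).
Qed.

Lemma is_cderive_id (z : C) : is_cderive (fun w => w) z (RtoC 1).
Proof. apply is_cderive_ring, (is_derive_id (K := C_AbsRing)). Qed.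

Lemma is_cderive_mult (f g : C -> C) (z l m : C) :
  is_cderive f z l -> is_cderive g z m ->
  is_cderive (fun w => f w * g w)%C z (l * g z + f z * m)%C.
Proof.
intros hf%is_cderive_ring hg%is_cderive_ring; apply is_cderive_ring.
apply (is_derive_mult (K := C_AbsRing) f g z l m hf hg Cmult_comm).
Qed.

Lemma is_cderive_comp (f g : C -> C) (z l m : C) :
  is_cderive f (g z) l -> is_cderive g z m ->
  is_cderive (fun w => f (g w)) z (m * l)%C.
Proof.
intros hf hg%is_cderive_ring.
apply (is_derive_comp (K := C_AbsRing) (V := C_NormedModule) f g z l m hf hg).
Qed.

Lemma is_cderive_continuous (f : C -> C) (z l : C) :
  is_cderive f z l -> forall eps, 0 < eps ->
  exists delta, 0 < delta /\
    forall w, Cmod (w - z) < delta -> Cmod (f w - f z) < eps.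
Proof.
intros H eps he.
destruct (proj1 (is_cderive_eps f z l) H 1 Rlt_0_1) as [d [hd H']].
pose proof (Cmod_ge_0 l) as hl.
exists (Rmin d (eps / (Cmod l + 2))); split.
{ apply Rmin_pos; [exact hd|]; apply Rdiv_lt_0_compat; lra. }
intros w hw.
pose proof (Rlt_le_trans _ _ _ hw (Rmin_l _ _)) as h1.
pose proof (Rlt_le_trans _ _ _ hw (Rmin_r _ _)) as h2.
specialize (H' w h1).
replace (f w - f z)%C with ((f w - f z - l * (w - z)) + l * (w - z))%C by ring.
eapply Rle_lt_trans; [apply Cmod_triangle|]; rewrite Cmod_mult.
apply Rle_lt_trans with ((Cmod l + 1) * Cmod (w - z)); [lra|].
apply Rmult_lt_compat_l with (r := Cmod l + 2) in h2; [|lra].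
replace ((Cmod l + 2) * (eps / (Cmod l + 2))) with eps in h2 by (field; lra).
pose proof (Cmod_ge_0 (w - z)); lra.
Qed.

Lemma is_cderive_Cinv (z : C) : z <> 0%C -> is_cderive Cinv z (- / (z * z))%C.
Proof.
intros hz; apply is_cderive_eps; intros eps he.
pose proof (proj1 (Cmod_gt_0 z) hz) as hm.
set (m := Cmod z) in *.
assert (hm3 : 0 < eps * m ^ 3 / 2).
{ apply Rdiv_lt_0_compat; [|lra]; apply Rmult_lt_0_compat; [lra|apply pow_lt; lra]. }
exists (Rmin (m / 2) (eps * m ^ 3 / 2)); split; [apply Rmin_pos; lra|].
intros w hw.
pose proof (Rlt_le_trans _ _ _ hw (Rmin_l _ _)) as h1.
pose proof (Rlt_le_trans _ _ _ hw (Rmin_r _ _)) as h2.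
assert (hw2 : m / 2 < Cmod w).
{ assert (m <= Cmod w + Cmod (w - z)); [|lra].
  unfold m; replace z with (w + - (w - z))%C at 1 by ring.
  rewrite <- (Cmod_opp (w - z)); apply Cmod_triangle. }
assert (hw0 : w <> 0%C) by (apply Cmod_gt_0; lra).
replace (/ w - / z - - / (z * z) * (w - z))%C
  with ((w - z) * ((w - z) / (w * (z * z))))%C
  by (field; split; assumption).
rewrite Cmod_mult, Rmult_comm; apply Rmult_le_compat_r; [apply Cmod_ge_0|].
rewrite Cmod_div, !Cmod_mult; [|repeat apply Cmult_neq_0; assumption].
fold m; assert (hmm : 0 < m * m) by (apply Rmult_lt_0_compat; lra).
apply Rmult_le_reg_r with (Cmod w * (m * m)).
{ apply Rmult_lt_0_compat; lra. }
unfold Rdiv; rewrite Rmult_assoc, Rinv_l by (apply Rgt_not_eq, Rmult_lt_0_compat; lra).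
rewrite Rmult_1_r; left; eapply Rlt_le_trans; [exact h2|].
replace (eps * m ^ 3 / 2) with (eps * (m / 2 * (m * m))) by (simpl; field).
apply Rmult_le_compat_l; [lra|]; apply Rmult_le_compat_r; lra.
Qed.

Lemma is_cderive_inv (f : C -> C) (z l : C) :
  is_cderive f z l -> f z <> 0%C ->
  is_cderive (fun w => / f w)%C z (- (l / (f z * f z)))%C.
Proof.
intros hf hz.
eapply is_cderive_eq;
  [exact (is_cderive_comp Cinv f z _ _ (is_cderive_Cinv _ hz) hf)|].
field; exact hz.
Qed.

Lemma is_cderive_pow (f : C -> C) (n : nat) (z l : C) :
  is_cderive f z l ->
  is_cderive (fun w => f w ^ n)%C z (INR n * l * f z ^ pred n)%C.
Proof.
intros hf; induction n as [|n IH].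
- eapply is_cderive_eq; [exact (is_cderive_const (RtoC 1) z)|]; simpl; ring.
- eapply is_cderive_eq; [exact (is_cderive_mult _ _ _ _ _ hf IH)|].
  rewrite S_INR, RtoC_plus; destruct n as [|n]; simpl; ring.
Qed.

(** The difference quotient of a continuous right inverse [g] of [f] is the
    reciprocal of a difference quotient of [f], so differentiability of [g]
    needs only its continuity.  This gives the logarithm from the exponential. *)
Lemma is_cderive_right_inverse (f g : C -> C) (z0 l0 : C) (r : R) :
  0 < r -> (forall w, Cmod (w - z0) < r -> f (g w) = w) ->
  (forall eps, 0 < eps -> exists delta, 0 < delta /\
     forall w, Cmod (w - z0) < delta -> Cmod (g w - g z0) < eps) ->
  is_cderive f (g z0) l0 -> l0 <> 0%C -> is_cderive g z0 (/ l0)%C.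
Proof.
intros hr hfg hc hf hl.
apply is_cderive_eps; intros eps he.
pose proof (proj1 (Cmod_gt_0 l0) hl) as hm; set (m := Cmod l0) in *.
assert (he' : 0 < Rmin (m / 2) (eps * (m * m) / 2)).
{ apply Rmin_pos; [lra|]; apply Rdiv_lt_0_compat; [|lra].
  apply Rmult_lt_0_compat; [lra|apply Rmult_lt_0_compat; lra]. }
destruct (proj1 (is_cderive_eps _ _ _) hf _ he') as [d1 [hd1 H1]].
destruct (hc d1 hd1) as [d2 [hd2 H2]].
exists (Rmin r d2); split; [apply Rmin_pos; lra|]; intros w hw.
specialize (H1 _ (H2 w (Rlt_le_trans _ _ _ hw (Rmin_r _ _)))).
rewrite (hfg w (Rlt_le_trans _ _ _ hw (Rmin_l _ _))) in H1.
rewrite hfg in H1 by (replace (z0 - z0)%C with (RtoC 0) by ring; rewrite Cmod_0; exact hr).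
set (k := (g w - g z0)%C) in *; set (h := (w - z0)%C) in *.
assert (hA : Cmod (h - l0 * k) <= m / 2 * Cmod k).
{ eapply Rle_trans; [exact H1|]; apply Rmult_le_compat_r; [apply Cmod_ge_0|apply Rmin_l]. }
assert (hB : Cmod (h - l0 * k) <= eps * (m * m) / 2 * Cmod k).
{ eapply Rle_trans; [exact H1|]; apply Rmult_le_compat_r; [apply Cmod_ge_0|apply Rmin_r]. }
assert (hk : m / 2 * Cmod k <= Cmod h).
{ assert (m * Cmod k <= Cmod h + Cmod (h - l0 * k)); [|lra].
  unfold m; rewrite <- Cmod_mult, <- (Cmod_opp (h - l0 * k)).
  replace (l0 * k)%C with (h + - (h - l0 * k))%C at 1 by ring; apply Cmod_triangle. }
replace (k - / l0 * h)%C with (- (/ l0 * (h - l0 * k)))%C by (field; exact hl).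
rewrite Cmod_opp, Cmod_mult, Cmod_inv by exact hl; fold m.
apply Rmult_le_reg_l with m; [exact hm|].
rewrite <- Rmult_assoc, Rinv_r, Rmult_1_l by lra.
eapply Rle_trans; [exact hB|].
replace (eps * (m * m) / 2 * Cmod k) with (m * eps * (m / 2 * Cmod k)) by field.
replace (m * (eps * Cmod h)) with (m * eps * Cmod h) by ring.
apply Rmult_le_compat_l; [apply Rmult_le_pos; lra|exact hk].
Qed.

(** * The exponential, the logarithm and powers of [1 - z] *)

Lemma Cmod_le_Rabs (z : C) : Cmod z <= Rabs (Re z) + Rabs (Im z).
Proof.
destruct z as [x y].
replace (x, y) with (RtoC x + Ci * RtoC y)%C
  by (unfold RtoC, Ci, Cplus, Cmult; simpl; f_equal; ring).
eapply Rle_trans; [apply Cmod_triangle|].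
rewrite Cmod_mult, Cmod_Ci, !Cmod_R; simpl.
replace (x + (0 * y - 1 * 0)) with x by ring.
replace (0 + (0 * 0 + 1 * y)) with y by ring; lra.
Qed.

Lemma im_le_Cmod (z : C) : Rabs (Im z) <= Cmod z.
Proof.
pose proof (Rmax_Cmod z) as H; eapply Rle_trans; [|exact H]; apply Rmax_r.
Qed.

Lemma Cexp_plus (z w : C) : Cexp (z + w) = (Cexp z * Cexp w)%C.
Proof.
destruct z as [x y], w as [u v]; unfold Cexp, Cplus, Cmult; simpl.
rewrite exp_plus, cos_plus, sin_plus; f_equal; ring.
Qed.

Lemma Cexp_0 : Cexp (RtoC 0) = RtoC 1.
Proof. unfold Cexp, RtoC; simpl; rewrite exp_0, cos_0, sin_0; f_equal; ring. Qed.

Lemma Cmod_Cexp (z : C) : Cmod (Cexp z) = exp (Re z).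
Proof.
unfold Cexp, Cmod; simpl.
replace (_ + _) with ((exp (Re z))² * ((sin (Im z))² + (cos (Im z))²)) by (unfold Rsqr; ring).
rewrite sin2_cos2, Rmult_1_r; apply sqrt_Rsqr, Rlt_le, exp_pos.
Qed.

Lemma Cexp_neq_0 (z : C) : Cexp z <> 0%C.
Proof. apply Cmod_gt_0; rewrite Cmod_Cexp; apply exp_pos. Qed.

Lemma derivable_pt_lim_at_0 (f : R -> R) (l eps : R) :
  derivable_pt_lim f 0 l -> 0 < eps -> exists delta, 0 < delta /\
    forall h, Rabs h < delta -> Rabs (f h - f 0 - l * h) <= eps * Rabs h.
Proof.
intros H he; destruct (H eps he) as [d hd].
exists d; split; [apply cond_pos|]; intros h hh.
destruct (Req_dec h 0) as [->|h0].
- rewrite Rmult_0_r; replace (f 0 - f 0 - 0) with 0 by ring; rewrite Rabs_R0; lra.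
- specialize (hd h h0 hh); rewrite Rplus_0_l in hd.
  replace (f h - f 0 - l * h) with (((f h - f 0) / h - l) * h) by (field; exact h0).
  rewrite Rabs_mult; apply Rmult_le_compat_r; [apply Rabs_pos|lra].
Qed.

(** Writing the exponential as [exp x * (cos y + i sin y)], the three real
    first order expansions at [0] add up to the complex one. *)
Lemma is_cderive_Cexp_0 : is_cderive Cexp (RtoC 0) (RtoC 1).
Proof.
apply is_cderive_eps; intros eps he.
set (e := Rmin (eps / 10) (1 / 10)).
assert (he' : 0 < e) by (apply Rmin_pos; lra).
assert (e1 : e <= eps / 10) by apply Rmin_l.
assert (e2 : e <= 1 / 10) by apply Rmin_r.
clearbody e.
destruct (derivable_pt_lim_at_0 exp 1 e derivable_pt_lim_exp_0 he') as [d1 [hd1 H1]].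
destruct (derivable_pt_lim_at_0 sin 1 e derivable_pt_lim_sin_0 he') as [d2 [hd2 H2]].
assert (hc0 : derivable_pt_lim cos 0 0).
{ replace 0 with (- sin 0) at 2 by (rewrite sin_0; ring); apply derivable_pt_lim_cos. }
destruct (derivable_pt_lim_at_0 cos 0 e hc0 he') as [d3 [hd3 H3]].
exists (Rmin (Rmin d1 d2) (Rmin d3 e)); split; [repeat apply Rmin_pos; assumption|].
intros w hw.
replace (w - RtoC 0)%C with w in * by ring.
rewrite Cexp_0; replace (Cexp w - 1 - 1 * w)%C with (Cexp w - 1 - w)%C by ring.
assert (hm : Cmod w < d1 /\ Cmod w < d2 /\ Cmod w < d3 /\ Cmod w < e).
{ pose proof (Rmin_l (Rmin d1 d2) (Rmin d3 e)); pose proof (Rmin_r (Rmin d1 d2) (Rmin d3 e)).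
  pose proof (Rmin_l d1 d2); pose proof (Rmin_r d1 d2).
  pose proof (Rmin_l d3 e); pose proof (Rmin_r d3 e); lra. }
destruct hm as [m1 [m2 [m3 m4]]].
pose proof (re_le_Cmod w) as hx; pose proof (im_le_Cmod w) as hy.
destruct w as [x y]; set (N := Cmod (x, y)) in *; simpl in hx, hy.
specialize (H1 x ltac:(lra)); specialize (H2 y ltac:(lra)); specialize (H3 y ltac:(lra)).
rewrite exp_0 in H1; rewrite sin_0 in H2; rewrite cos_0 in H3.
eapply Rle_trans; [apply Cmod_le_Rabs|]; unfold Cexp; simpl.
pose proof (Rabs_pos x) as px; pose proof (Rabs_pos y) as py.
assert (hc : Rabs (cos y) <= 1) by (apply Rabs_le; pose proof (COS_bound y); lra).
assert (hs : Rabs (sin y) <= 1) by (apply Rabs_le; pose proof (SIN_bound y); lra).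
replace (exp x * cos y + - (1) + - x)
  with ((exp x - 1 - 1 * x) * cos y + (1 + x) * (cos y - 1 - 0 * y)) by ring.
replace (exp x * sin y + - 0 + - y)
  with ((exp x - 1 - 1 * x) * sin y + x * (sin y - 0 - 1 * y) + x * y + (sin y - 0 - 1 * y)) by ring.
assert (K : forall a b A B, Rabs a <= A -> Rabs b <= B -> Rabs (a * b) <= A * B).
{ intros; rewrite Rabs_mult; apply Rmult_le_compat; auto using Rabs_pos. }
assert (T1 := K _ _ _ _ H1 hc).
assert (T2 := K (1 + x) _ 2 _ ltac:(apply Rabs_le; apply Rabs_le_between in hx; lra) H3).
assert (T3 := K _ _ _ _ H1 hs).
assert (T4 := K x _ 1 _ ltac:(lra) H2).
assert (T5 := K x y e N ltac:(lra) hy).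
assert (X1 : e * Rabs x <= e * N) by (apply Rmult_le_compat_l; lra).
assert (X2 : e * Rabs y <= e * N) by (apply Rmult_le_compat_l; lra).
assert (X3 : e * N <= eps / 10 * N) by (apply Rmult_le_compat_r; lra).
assert (X4 : 0 <= eps * N) by (apply Rmult_le_pos; [lra|apply Cmod_ge_0]).
eapply Rle_trans.
{ apply Rplus_le_compat; [eapply Rle_trans; [apply Rabs_triang|]; apply Rplus_le_compat; eassumption|].
  eapply Rle_trans; [apply Rabs_triang|]; apply Rplus_le_compat; [|exact H2].
  eapply Rle_trans; [apply Rabs_triang|]; apply Rplus_le_compat; [|exact T5].
  eapply Rle_trans; [apply Rabs_triang|]; apply Rplus_le_compat; eassumption. }
lra.
Qed.

Lemma is_cderive_Cexp (z : C) : is_cderive Cexp z (Cexp z).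
Proof.
apply (is_cderive_ext_ball (fun w => Cexp z * Cexp (w - z))%C _ _ _ 1 Rlt_0_1).
{ intros w _; rewrite <- Cexp_plus; f_equal; ring. }
assert (H : is_cderive (fun w => Cexp (w - z)) z (RtoC 1)).
{ eapply is_cderive_eq.
  - apply (is_cderive_comp Cexp (fun w => w - z)%C z (RtoC 1) (RtoC 1 - RtoC 0)%C).
    + replace (z - z)%C with (RtoC 0) by ring; exact is_cderive_Cexp_0.
    + apply is_cderive_minus; [apply is_cderive_id|apply is_cderive_const].
  - ring. }
eapply is_cderive_eq; [exact (is_cderive_mult _ _ _ _ _ (is_cderive_const (Cexp z) z) H)|].
cbv beta; ring.
Qed.

Lemma continuous_Cmod_ball (g : C -> R) (z : C) :
  @continuous C_UniformSpace R_UniformSpace g z -> forall eps, 0 < eps ->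
  exists delta, 0 < delta /\
    forall w, Cmod (w - z) < delta -> Rabs (g w - g z) < eps.
Proof.
intros H eps he.
destruct (proj1 (filterlim_locally g (g z)) H (mkposreal eps he)) as [d hd].
exists d; split; [apply cond_pos|]; intros w hw.
apply (hd w); split.
- eapply Rle_lt_trans; [|exact hw]; apply (re_le_Cmod (w - z)%C).
- eapply Rle_lt_trans; [|exact hw]; apply (im_le_Cmod (w - z)%C).
Qed.

Lemma Clog_rhp_continuous (z : C) : 0 < Re z -> forall eps, 0 < eps ->
  exists delta, 0 < delta /\
    forall w, Cmod (w - z) < delta -> Cmod (Clog_rhp w - Clog_rhp z) < eps.
Proof.
intros hz eps he.
assert (c1 : @continuous C_UniformSpace R_UniformSpace (fun w => ln (Cmod w)) z).
{ apply (continuous_comp (V := R_UniformSpace) Cmod ln).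
  - apply (continuous_ext (T := C_UniformSpace) (U := R_UniformSpace)
      (fun w => @norm R_AbsRing C_R_NormedModule w) Cmod z (fun w => eq_sym (Cmod_norm w))).
    apply (filterlim_norm (K := R_AbsRing) (V := C_R_NormedModule) z).
  - apply (ex_derive_continuous (V := R_NormedModule)); exists (/ Cmod z); apply is_derive_ln.
    apply Cmod_gt_0; intros ->; simpl in hz; lra. }
assert (c2 : @continuous C_UniformSpace R_UniformSpace (fun w => atan (Im w / Re w)) z).
{ apply (continuous_comp (V := R_UniformSpace) (fun w => Im w / Re w) atan).
  - apply (continuous_mult (K := R_AbsRing) (U := C_UniformSpace) (fun w => Im w) (fun w => / Re w)).
    + apply (continuous_snd (U := R_UniformSpace) (V := R_UniformSpace)).
    + apply (continuous_comp (V := R_UniformSpace) (fun w => Re w) Rinv);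
        [apply (continuous_fst (U := R_UniformSpace) (V := R_UniformSpace))|].
      apply continuous_Rinv; lra.
  - apply (ex_derive_continuous (V := R_NormedModule)); eexists; apply is_derive_atan. }
destruct (continuous_Cmod_ball _ _ c1 (eps / 2) ltac:(lra)) as [d1 [hd1 H1]].
destruct (continuous_Cmod_ball _ _ c2 (eps / 2) ltac:(lra)) as [d2 [hd2 H2]].
exists (Rmin d1 d2); split; [apply Rmin_pos; assumption|]; intros w hw.
specialize (H1 w (Rlt_le_trans _ _ _ hw (Rmin_l _ _))).
specialize (H2 w (Rlt_le_trans _ _ _ hw (Rmin_r _ _))).
eapply Rle_lt_trans; [apply Cmod_le_Rabs|].
replace (Re (Clog_rhp w - Clog_rhp z)) with (ln (Cmod w) - ln (Cmod z)) by reflexivity.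
replace (Im (Clog_rhp w - Clog_rhp z)) with (atan (Im w / Re w) - atan (Im z / Re z)) by reflexivity.
lra.
Qed.

Lemma is_cderive_Clog_rhp (z : C) : 0 < Re z -> is_cderive Clog_rhp z (/ z)%C.
Proof.
intros hz.
apply (is_cderive_right_inverse Cexp Clog_rhp z z (Re z) hz).
- intros w hw; apply Cexp_Clog_rhp.
  pose proof (Rle_lt_trans _ _ _ (re_le_Cmod (w - z)%C) hw) as h.
  apply Rabs_lt_between in h; change (Re (w - z)%C) with (Re w - Re z) in h; lra.
- exact (Clog_rhp_continuous z hz).
- rewrite <- (Cexp_Clog_rhp z hz) at 2; apply is_cderive_Cexp.
- intros ->; simpl in hz; lra.
Qed.

Lemma one_minus_disk_neq_0 (z : C) : in_disk z -> (1 - z)%C <> 0%C.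
Proof. intros h%Re_one_minus_disk E; rewrite E in h; simpl in h; lra. Qed.

Lemma is_cderive_frak_q (s : R) (z : C) : in_disk z ->
  is_cderive (frak_q s) z (s * frak_q s z / (1 - z))%C.
Proof.
intros hz; unfold frak_q.
eapply is_cderive_eq.
- apply (is_cderive_comp Cexp (fun w => - RtoC s * Clog_rhp (1 - w))%C); [apply is_cderive_Cexp|].
  apply is_cderive_mult; [apply is_cderive_const|].
  apply (is_cderive_comp Clog_rhp (fun w => 1 - w)%C).
  + apply is_cderive_Clog_rhp, Re_one_minus_disk, hz.
  + apply is_cderive_minus; [apply is_cderive_const|apply is_cderive_id].
- cbv beta; field; apply one_minus_disk_neq_0, hz.
Qed.

Lemma frak_q_neq_0 (s : R) (z : C) : frak_q s z <> 0%C.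
Proof. apply Cexp_neq_0. Qed.

(** * Integrals of complex valued functions of a real variable *)

Notation is_CInt := (@is_RInt C_R_NormedModule).
Notation ex_CInt := (@ex_RInt C_R_NormedModule).
Notation CInt := (@RInt C_R_CompleteNormedModule).
Notation ccontinuous := (@continuous R_UniformSpace C_UniformSpace).

Lemma ccontinuous_eps (g : R -> C) (t : R) :
  (forall eps, 0 < eps -> exists delta, 0 < delta /\
     forall u, Rabs (u - t) < delta -> Cmod (g u - g t) < eps) ->
  ccontinuous g t.
Proof.
intros H; apply filterlim_locally; intros [eps he].
destruct (H eps he) as [d [hd H']].
exists (mkposreal d hd); intros u hu; specialize (H' u hu); split.
- eapply Rle_lt_trans; [apply (re_le_Cmod (g u - g t)%C)|exact H'].
- eapply Rle_lt_trans; [apply (im_le_Cmod (g u - g t)%C)|exact H'].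
Qed.

Lemma ex_CInt_continuous (g : R -> C) (a b : R) :
  a <= b -> (forall t, a <= t <= b -> ccontinuous g t) -> ex_CInt g a b.
Proof.
intros hab H; apply (ex_RInt_continuous (V := C_R_CompleteNormedModule)).
rewrite Rmin_left, Rmax_right by exact hab; exact H.
Qed.

Lemma CInt_correct (g : R -> C) (a b : R) :
  ex_CInt g a b -> is_CInt g a b (CInt g a b).
Proof. apply (RInt_correct (V := C_R_CompleteNormedModule)). Qed.

Lemma is_CInt_unique (g : R -> C) (a b : R) (l : C) :
  is_CInt g a b l -> CInt g a b = l.
Proof. apply (is_RInt_unique (V := C_R_CompleteNormedModule)). Qed.

Lemma is_CInt_plus (f g : R -> C) (a b : R) (l m : C) :
  is_CInt f a b l -> is_CInt g a b m ->
  is_CInt (fun t => f t + g t)%C a b (l + m)%C.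
Proof. apply (is_RInt_plus (V := C_R_NormedModule)). Qed.

Lemma is_CInt_minus (f g : R -> C) (a b : R) (l m : C) :
  is_CInt f a b l -> is_CInt g a b m ->
  is_CInt (fun t => f t - g t)%C a b (l - m)%C.
Proof. apply (is_RInt_minus (V := C_R_NormedModule)). Qed.

Lemma is_CInt_pair (f : R -> C) (a b : R) (l : C) :
  is_CInt f a b l <->
  is_RInt (fun t => Re (f t)) a b (Re l) /\ is_RInt (fun t => Im (f t)) a b (Im l).
Proof.
split.
- intros H; split.
  + exact (is_RInt_fct_extend_fst (U := R_NormedModule) (V := R_NormedModule) f a b l H).
  + exact (is_RInt_fct_extend_snd (U := R_NormedModule) (V := R_NormedModule) f a b l H).
- intros [h1 h2]; destruct l as [l1 l2].
  exact (is_RInt_fct_extend_pair (U := R_NormedModule) (V := R_NormedModule) f a b _ _ h1 h2).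
Qed.

Lemma is_CInt_scal (c : C) (f : R -> C) (a b : R) (l : C) :
  is_CInt f a b l -> is_CInt (fun t => c * f t)%C a b (c * l)%C.
Proof.
intros [h1 h2]%is_CInt_pair; apply is_CInt_pair; split.
- apply (is_RInt_minus (V := R_NormedModule)); apply (is_RInt_scal (V := R_NormedModule)); assumption.
- apply (is_RInt_plus (V := R_NormedModule)); apply (is_RInt_scal (V := R_NormedModule)); assumption.
Qed.

Lemma Cmod_is_CInt_le (f : R -> C) (g : R -> R) (a b : R) (l : C) (m : R) :
  a <= b -> (forall t, a <= t <= b -> Cmod (f t) <= g t) ->
  is_CInt f a b l -> is_RInt g a b m -> Cmod l <= m.
Proof.
intros hab H hf hg; rewrite Cmod_norm.
refine (norm_RInt_le (V := C_R_NormedModule) f g a b l m hab _ hf hg).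
intros t ht; rewrite <- Cmod_norm; apply H, ht.
Qed.

Lemma Cmod_is_CInt_le_const (f : R -> C) (a b : R) (l : C) (m : R) :
  a <= b -> (forall t, a <= t <= b -> Cmod (f t) <= m) ->
  is_CInt f a b l -> Cmod l <= (b - a) * m.
Proof.
intros hab H hf; apply (Cmod_is_CInt_le f (fun _ => m) a b l _ hab H hf).
apply (is_RInt_const (V := R_NormedModule)).
Qed.

(** These are the integrals that Goursat's theorem compares with: affine
    functions have a primitive, so their boundary integrals vanish. *)
Lemma is_CInt_affine (c d : C) (a b : R) :
  is_CInt (fun t => c + d * t)%C a b (c * (b - a) + d * ((b * b - a * a) / 2))%C.
Proof.
assert (K : forall al be, is_RInt (fun t => al + be * t) a b (al * (b - a) + be * ((b * b - a * a) / 2))).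
{ intros al be.
  replace (al * (b - a) + be * ((b * b - a * a) / 2))
    with ((fun t => al * t + be * (t * t / 2)) b - (fun t => al * t + be * (t * t / 2)) a)
    by (cbv beta; field).
  apply (is_RInt_derive (V := R_CompleteNormedModule) (fun t => al * t + be * (t * t / 2))).
  - intros t _; auto_derive; [exact I|field].
  - intros t _; apply (ex_derive_continuous (V := R_NormedModule)); auto_derive; exact I. }
apply is_CInt_pair; destruct c as [c1 c2], d as [d1 d2]; split.
- eapply is_RInt_ext; [|eapply eq_rect; [apply (K c1 d1)|]].
  + intros t _; simpl; ring.
  + simpl; field.
- eapply is_RInt_ext; [|eapply eq_rect; [apply (K c2 d2)|]].
  + intros t _; simpl; ring.
  + simpl; field.
Qed.

(** * Goursat's theorem for rectangles *)

(** The integral of [v (z) dz] along the boundary, run counterclockwise, of the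
    rectangle with lower left corner [(x, y)], width [A] and height [B]. *)
Definition rect_int (v : C -> C) (x A y B : R) : C :=
  (CInt (fun t => v (t, y)) x (x + A) - CInt (fun t => v (t, (y + B)%R)) x (x + A)
   + Ci * (CInt (fun t => v ((x + A)%R, t)) y (y + B) - CInt (fun t => v (x, t)) y (y + B)))%C.

Definition diff_on_rect (v : C -> C) (x A y B : R) : Prop :=
  forall p q, x <= p <= x + A -> y <= q <= y + B -> ex_cderive v (p, q).

Lemma Cmod_pair_horizontal (a b y : R) : Cmod ((a, y) - (b, y))%C = Rabs (a - b).
Proof.
replace ((a, y) - (b, y))%C with (RtoC (a - b)); [apply Cmod_R|].
unfold RtoC, Cminus, Cplus, Copp; simpl; f_equal; ring.
Qed.

Lemma Cmod_pair_vertical (x a b : R) : Cmod ((x, a) - (x, b))%C = Rabs (a - b).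
Proof.
replace ((x, a) - (x, b))%C with (Ci * RtoC (a - b))%C.
- rewrite Cmod_mult, Cmod_Ci, Cmod_R; ring.
- unfold RtoC, Ci, Cmult, Cminus, Cplus, Copp; simpl; f_equal; ring.
Qed.

Lemma ccontinuous_horizontal (v : C -> C) (x y : R) :
  ex_cderive v (x, y) -> ccontinuous (fun t => v (t, y)) x.
Proof.
intros [l H]; apply ccontinuous_eps; intros eps he.
destruct (is_cderive_continuous v _ l H eps he) as [d [hd H']].
exists d; split; [exact hd|]; intros u hu; apply H'.
rewrite Cmod_pair_horizontal; exact hu.
Qed.

Lemma ccontinuous_vertical (v : C -> C) (x y : R) :
  ex_cderive v (x, y) -> ccontinuous (fun t => v (x, t)) y.
Proof.
intros [l H]; apply ccontinuous_eps; intros eps he.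
destruct (is_cderive_continuous v _ l H eps he) as [d [hd H']].
exists d; split; [exact hd|]; intros u hu; apply H'.
rewrite Cmod_pair_vertical; exact hu.
Qed.

Lemma ex_CInt_horizontal (v : C -> C) (x A y B q a b : R) :
  diff_on_rect v x A y B -> y <= q <= y + B -> x <= a -> a <= b -> b <= x + A ->
  ex_CInt (fun t => v (t, q)) a b.
Proof.
intros H hq h1 h2 h3; apply ex_CInt_continuous; [exact h2|].
intros t ht; apply ccontinuous_horizontal, H; lra.
Qed.

Lemma ex_CInt_vertical (v : C -> C) (x A y B p a b : R) :
  diff_on_rect v x A y B -> x <= p <= x + A -> y <= a -> a <= b -> b <= y + B ->
  ex_CInt (fun t => v (p, t)) a b.
Proof.
intros H hp h1 h2 h3; apply ex_CInt_continuous; [exact h2|].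
intros t ht; apply ccontinuous_vertical, H; lra.
Qed.

Lemma CInt_Chasles (f : R -> C) (a b c : R) :
  ex_CInt f a b -> ex_CInt f b c -> CInt f a c = (CInt f a b + CInt f b c)%C.
Proof. intros h1 h2; symmetry; apply (RInt_Chasles (V := C_R_CompleteNormedModule) f a b c h1 h2). Qed.

(** The contributions of the inner segments cancel, each being run twice in
    opposite directions. *)
Lemma rect_int_quarter (v : C -> C) (x A y B : R) :
  0 <= A -> 0 <= B -> diff_on_rect v x A y B ->
  rect_int v x A y B =
    (rect_int v x (A / 2) y (B / 2) + rect_int v (x + A / 2) (A / 2) y (B / 2)
     + (rect_int v x (A / 2) (y + B / 2) (B / 2)
        + rect_int v (x + A / 2) (A / 2) (y + B / 2) (B / 2)))%C.
Proof.
intros hA hB H; unfold rect_int.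
replace (x + A / 2 + A / 2) with (x + A) by field.
replace (y + B / 2 + B / 2) with (y + B) by field.
assert (h : forall q, y <= q <= y + B ->
  CInt (fun t => v (t, q)) x (x + A)
  = (CInt (fun t => v (t, q)) x (x + A / 2) + CInt (fun t => v (t, q)) (x + A / 2) (x + A))%C).
{ intros q hq; apply CInt_Chasles; apply (ex_CInt_horizontal v x A y B q); (exact H || lra). }
assert (k : forall p, x <= p <= x + A ->
  CInt (fun t => v (p, t)) y (y + B)
  = (CInt (fun t => v (p, t)) y (y + B / 2) + CInt (fun t => v (p, t)) (y + B / 2) (y + B))%C).
{ intros q hq; apply CInt_Chasles; apply (ex_CInt_vertical v x A y B q); (exact H || lra). }
rewrite (h y), (h (y + B)), (k x), (k (x + A)) by lra; ring.
Qed.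

Lemma diff_on_subrect (v : C -> C) (x A y B x' A' y' B' : R) :
  diff_on_rect v x A y B -> x <= x' -> x' + A' <= x + A -> y <= y' -> y' + B' <= y + B ->
  diff_on_rect v x' A' y' B'.
Proof. intros H h1 h2 h3 h4 p q hp hq; apply H; lra. Qed.

(** The affine function contributes nothing, and the rest is at most the
    perimeter times the distance [e]. *)
Lemma rect_int_near_affine (v : C -> C) (x A y B e : R) (c d : C) :
  0 <= A -> 0 <= B -> diff_on_rect v x A y B ->
  (forall p q, x <= p <= x + A -> y <= q <= y + B ->
     Cmod (v (p, q) - (c + d * (p, q))) <= e) ->
  Cmod (rect_int v x A y B) <= 2 * (A + B) * e.
Proof.
intros hA hB H hv; unfold rect_int.
assert (Eh : forall p q : R, (c + d * (p, q))%C = ((c + d * Ci * q) + d * p)%C).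
{ intros p q; replace ((p, q) : C) with (RtoC p + Ci * RtoC q)%C; [ring|].
  unfold RtoC, Ci, Cmult, Cplus; simpl; f_equal; ring. }
assert (Ev : forall p q : R, (c + d * (p, q))%C = ((c + d * p) + d * Ci * q)%C)
  by (intros; rewrite Eh; ring).
assert (kh : forall q, y <= q <= y + B ->
  Cmod (CInt (fun t => v (t, q)) x (x + A)
    - ((c + d * Ci * q) * (RtoC (x + A) - x) + d * ((RtoC (x + A) * RtoC (x + A) - x * x) / 2)))%C
  <= (x + A - x) * e).
{ intros q hq.
  apply (Cmod_is_CInt_le_const (fun t => v (t, q) - ((c + d * Ci * q) + d * t))%C); [lra| |].
  - intros t ht; rewrite <- Eh; apply hv; lra.
  - apply is_CInt_minus; [|apply is_CInt_affine].
    apply CInt_correct, (ex_CInt_horizontal v x A y B q); (exact H || lra). }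
assert (kv : forall p, x <= p <= x + A ->
  Cmod (CInt (fun t => v (p, t)) y (y + B)
    - ((c + d * p) * (RtoC (y + B) - y) + d * Ci * ((RtoC (y + B) * RtoC (y + B) - y * y) / 2)))%C
  <= (y + B - y) * e).
{ intros p hp.
  apply (Cmod_is_CInt_le_const (fun t => v (p, t) - ((c + d * p) + d * Ci * t))%C); [lra| |].
  - intros t ht; rewrite <- Ev; apply hv; lra.
  - apply is_CInt_minus; [|apply is_CInt_affine].
    apply CInt_correct, (ex_CInt_vertical v x A y B p); (exact H || lra). }
pose proof (kh y ltac:(lra)) as h1; pose proof (kh (y + B) ltac:(lra)) as h2.
pose proof (kv (x + A) ltac:(lra)) as h3; pose proof (kv x ltac:(lra)) as h4.
set (I1 := CInt (fun t => v (t, y)) x (x + A)) in *.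
set (I2 := CInt (fun t => v (t, y + B)) x (x + A)) in *.
set (I3 := CInt (fun t => v (x + A, t)) y (y + B)) in *.
set (I4 := CInt (fun t => v (x, t)) y (y + B)) in *.
rewrite !RtoC_plus in *.
match type of h1 with Cmod (_ - ?k) <= _ => set (K1 := k) in * end.
match type of h2 with Cmod (_ - ?k) <= _ => set (K2 := k) in * end.
match type of h3 with Cmod (_ - ?k) <= _ => set (K3 := k) in * end.
match type of h4 with Cmod (_ - ?k) <= _ => set (K4 := k) in * end.
assert (E0 : (K1 - K2 + Ci * (K3 - K4) = 0)%C).
{ unfold K1, K2, K3, K4; field. }
replace (I1 - I2 + Ci * (I3 - I4))%C
  with ((I1 - K1) + - (I2 - K2) + Ci * ((I3 - K3) + - (I4 - K4)))%C
  by (transitivity (I1 - I2 + Ci * (I3 - I4) - (K1 - K2 + Ci * (K3 - K4)))%C; [ring|rewrite E0; ring]).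
eapply Rle_trans; [apply Cmod_triangle|].
rewrite Cmod_mult, Cmod_Ci, Rmult_1_l.
eapply Rle_trans; [apply Rplus_le_compat; apply Cmod_triangle|].
rewrite !Cmod_opp; lra.
Qed.

Lemma nested_intervals (a b : nat -> R) :
  (forall m n, a m <= b n) -> exists l, forall n, a n <= l <= b n.
Proof.
intros H; destruct (completeness (fun r => exists n, r = a n)) as [l [h1 h2]].
- exists (b O); intros r [n ->]; apply H.
- exists (a O), O; reflexivity.
- exists l; intros n; split.
  + apply h1; exists n; reflexivity.
  + apply h2; intros r [m ->]; apply H.
Qed.

Lemma Cmod_quarter (a b c d : C) (e : R) :
  4 * e < Cmod (a + b + (c + d)) ->
  e < Cmod a \/ e < Cmod b \/ e < Cmod c \/ e < Cmod d.
Proof.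
intros H.
pose proof (Cmod_triangle (a + b) (c + d)); pose proof (Cmod_triangle a b).
pose proof (Cmod_triangle c d).
destruct (Rlt_dec e (Cmod a)) as [|na]; [tauto|].
destruct (Rlt_dec e (Cmod b)) as [|nb]; [tauto|].
destruct (Rlt_dec e (Cmod c)) as [|nc]; [tauto|].
right; right; right; lra.
Qed.

(** One of the four quarters of a rectangle carries at least a quarter of the
    boundary integral, and it has a quarter of the area.  Iterating gives
    rectangles that shrink to a point while the ratio of integral to area
    stays bounded below. *)
Section Bisection.

Variables (v : C -> C) (x A y B e : R).
Hypotheses (hA : 0 < A) (hB : 0 < B) (hv : diff_on_rect v x A y B).
Hypothesis he : e < Cmod (rect_int v x A y B).

Let large (n : nat) (c : R * R) : Prop :=
  e / 4 ^ n < Cmod (rect_int v (fst c) (A / 2 ^ n) (snd c) (B / 2 ^ n)).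

Let inside (n : nat) (c : R * R) : Prop :=
  x <= fst c /\ fst c + A / 2 ^ n <= x + A /\ y <= snd c /\ snd c + B / 2 ^ n <= y + B.

Let child (n : nat) (c c' : R * R) : Prop :=
  fst c <= fst c' /\ fst c' + A / 2 ^ S n <= fst c + A / 2 ^ n /\
  snd c <= snd c' /\ snd c' + B / 2 ^ S n <= snd c + B / 2 ^ n.

Lemma bisection_step (n : nat) (c : R * R) :
  inside n c -> large n c -> exists c', inside (S n) c' /\ large (S n) c' /\ child n c c'.
Proof.
destruct c as [p q]; unfold inside, large, child; cbn [fst snd]; intros [i1 [i2 [i3 i4]]] hl.
pose proof (pow_lt 2 n ltac:(lra)) as h2; pose proof (pow_lt 4 n ltac:(lra)) as h4.
assert (pA : 0 < A / 2 ^ n) by (apply Rdiv_lt_0_compat; assumption).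
assert (pB : 0 < B / 2 ^ n) by (apply Rdiv_lt_0_compat; assumption).
replace (A / 2 ^ S n) with (A / 2 ^ n / 2) by (simpl; field; lra).
replace (B / 2 ^ S n) with (B / 2 ^ n / 2) by (simpl; field; lra).
replace (e / 4 ^ n) with (4 * (e / 4 ^ S n)) in hl by (simpl; field; lra).
set (A' := A / 2 ^ n) in *; set (B' := B / 2 ^ n) in *.
rewrite rect_int_quarter in hl;
  [|lra|lra|apply (diff_on_subrect v x A y B); (exact hv || lra)].
destruct (Cmod_quarter _ _ _ _ _ hl) as [k|[k|[k|k]]].
- exists (p, q); cbn [fst snd]; repeat split; (exact k || lra).
- exists (p + A' / 2, q); cbn [fst snd]; repeat split; (exact k || lra).
- exists (p, q + B' / 2); cbn [fst snd]; repeat split; (exact k || lra).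
- exists (p + A' / 2, q + B' / 2); cbn [fst snd]; repeat split; (exact k || lra).
Qed.

Let state (n : nat) : Type := {c : R * R | inside n c /\ large n c}.

Lemma bisection_next (n : nat) (c : state n) :
  {c' : state (S n) | child n (proj1_sig c) (proj1_sig c')}.
Proof.
apply constructive_indefinite_description; destruct c as [c [hi hl]].
destruct (bisection_step n c hi hl) as [c' [hi' [hl' hc]]].
exists (exist _ c' (conj hi' hl')); exact hc.
Qed.

Lemma bisection_start : inside 0 (x, y) /\ large 0 (x, y).
Proof.
unfold inside, large; cbn [fst snd pow]; rewrite !Rdiv_1_r; repeat split; lra.
Qed.

Fixpoint bisection (n : nat) : state n :=
  match n with
  | O => exist _ (x, y) bisection_start
  | S m => proj1_sig (bisection_next m (bisection m))
  end.

Let corner (n : nat) : R * R := proj1_sig (bisection n).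

Lemma corner_child (n : nat) : child n (corner n) (corner (S n)).
Proof. exact (proj2_sig (bisection_next n (bisection n))). Qed.

Lemma corner_monotone (m n : nat) : (m <= n)%nat ->
  fst (corner m) <= fst (corner n) /\ fst (corner n) + A / 2 ^ n <= fst (corner m) + A / 2 ^ m /\
  snd (corner m) <= snd (corner n) /\ snd (corner n) + B / 2 ^ n <= snd (corner m) + B / 2 ^ m.
Proof.
induction 1 as [|n _ IH]; [lra|].
destruct (corner_child n) as [h1 [h2 [h3 h4]]]; lra.
Qed.

Lemma bisection_limit : exists p q, x <= p <= x + A /\ y <= q <= y + B /\
  forall n, exists x' y',
    x <= x' /\ x' <= p /\ p <= x' + A / 2 ^ n /\ x' + A / 2 ^ n <= x + A /\
    y <= y' /\ y' <= q /\ q <= y' + B / 2 ^ n /\ y' + B / 2 ^ n <= y + B /\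
    e / 4 ^ n < Cmod (rect_int v x' (A / 2 ^ n) y' (B / 2 ^ n)).
Proof.
assert (pA : forall n, 0 < A / 2 ^ n) by (intros; apply Rdiv_lt_0_compat; [lra|apply pow_lt; lra]).
assert (pB : forall n, 0 < B / 2 ^ n) by (intros; apply Rdiv_lt_0_compat; [lra|apply pow_lt; lra]).
assert (K : forall m n, fst (corner m) <= fst (corner n) + A / 2 ^ n /\
                        snd (corner m) <= snd (corner n) + B / 2 ^ n).
{ intros m n; pose proof (pA m); pose proof (pA n); pose proof (pB m); pose proof (pB n).
  destruct (Nat.le_ge_cases m n) as [h|h]; apply corner_monotone in h; lra. }
destruct (nested_intervals _ _ (fun m n => proj1 (K m n))) as [p hp].
destruct (nested_intervals _ _ (fun m n => proj2 (K m n))) as [q hq].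
exists p, q.
assert (L : forall n, inside n (corner n) /\ large n (corner n))
  by (intros n; exact (proj2_sig (bisection n))).
destruct (L O) as [[h1 [h2 [h3 h4]]] _]; pose proof (hp O); pose proof (hq O).
split; [lra|split; [lra|]].
intros n; exists (fst (corner n)), (snd (corner n)).
destruct (L n) as [[k1 [k2 [k3 k4]]] hl]; specialize (hp n); specialize (hq n).
repeat split; (exact hl || lra).
Qed.

End Bisection.

(** Goursat: at the limit point of the bisection [v] is affine up to a term
    of smaller order, which makes the ratio of integral to area as small as
    one likes.  The argument works from bare differentiability, which is what a
    subordination gives for [omega]. *)
Theorem rect_int_0 (v : C -> C) (x A y B : R) :
  0 < A -> 0 < B -> diff_on_rect v x A y B -> rect_int v x A y B = 0%C.
Proof.
intros hA hB H; apply NNPP; intros hn.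
pose proof (proj1 (Cmod_gt_0 _) hn) as hpos.
set (e := Cmod (rect_int v x A y B) / 2).
destruct (bisection_limit v x A y B e hA hB H ltac:(unfold e; lra)) as [p [q [hp [hq L]]]].
assert (he : 0 < e) by (unfold e; lra).
destruct (H p q hp hq) as [l hl].
(* On a rectangle of the bisection the integral is at most
   [2 * eta * (A + B) ^ 2 / 4 ^ n], half of the lower bound [e / 4 ^ n]. *)
set (eta := e / (4 * (A + B) * (A + B))).
assert (hAB : 0 < (A + B) * (A + B)) by (apply Rmult_lt_0_compat; lra).
assert (heta : 0 < eta) by (apply Rdiv_lt_0_compat; lra).
destruct (proj1 (is_cderive_eps _ _ _) hl eta heta) as [d [hd H']].
destruct (pow_lt_1_zero (/ 2) ltac:(rewrite Rabs_pos_eq; lra) (d / (A + B))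
  ltac:(apply Rdiv_lt_0_compat; lra)) as [n hN].
specialize (hN n (le_n n)); pose proof (pow_lt 2 n ltac:(lra)) as h2.
rewrite pow_inv, Rabs_pos_eq in hN by (left; apply Rinv_0_lt_compat; exact h2).
assert (hsz : (A + B) / 2 ^ n < d).
{ apply Rmult_lt_compat_l with (r := A + B) in hN; [|lra].
  replace ((A + B) * (d / (A + B))) with d in hN by (field; lra); exact hN. }
destruct (L n) as [x' [y' [k1 [k2 [k3 [k4 [k5 [k6 [k7 [k8 k9]]]]]]]]]].
set (A' := A / 2 ^ n) in *; set (B' := B / 2 ^ n) in *.
assert (hA' : 0 < A') by (apply Rdiv_lt_0_compat; lra).
assert (hB' : 0 < B') by (apply Rdiv_lt_0_compat; lra).
replace ((A + B) / 2 ^ n) with (A' + B') in hsz by (unfold A', B'; field; lra).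
apply Rlt_not_le in k9; apply k9; clear k9.
eapply Rle_trans.
- apply (rect_int_near_affine v x' A' y' B' (eta * (A' + B')) (v (p, q) - l * (p, q))%C l).
  + lra.
  + lra.
  + apply (diff_on_subrect v x A y B); (exact H || lra).
  + intros p' q' hp' hq'.
    assert (hdist : Cmod ((p', q') - (p, q)) <= A' + B').
    { replace ((p', q') - (p, q))%C with (((p', q') - (p, q')) + ((p, q') - (p, q)))%C by ring.
      eapply Rle_trans; [apply Cmod_triangle|].
      rewrite Cmod_pair_horizontal, Cmod_pair_vertical.
      apply Rplus_le_compat; apply Rabs_le; lra. }
    replace (v (p', q') - (v (p, q) - l * (p, q) + l * (p', q')))%C
      with (v (p', q') - v (p, q) - l * ((p', q') - (p, q)))%C by ring.
    eapply Rle_trans; [apply H'; lra|].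
    apply Rmult_le_compat_l; lra.
- replace (2 * (A' + B') * (eta * (A' + B'))) with (e / 4 ^ n / 2).
  + pose proof (pow_lt 4 n ltac:(lra)); assert (0 < e / 4 ^ n) by (apply Rdiv_lt_0_compat; lra); lra.
  + replace (4 ^ n) with (2 ^ n * 2 ^ n) by (rewrite <- Rpow_mult_distr; f_equal; ring).
    unfold eta, A', B'; field; split; lra.
Qed.

(** * Means over circles *)

Definition Csum (f : nat -> C) (n : nat) : C := @sum_n C_AbelianMonoid f n.

Definition circ (r t : R) : C := (r * cos t, r * sin t).

(** [m] is the average of [w] over the circle of radius [r].  The relation
    carries integrability with it, so the algebra of means needs no side
    conditions. *)
Definition is_cmean (w : C -> C) (r : R) (m : C) : Prop :=
  is_CInt (fun t => w (circ r t)) 0 (2 * PI) (RtoC (2 * PI) * m)%C.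

Definition holomorphic_punctured (rho : R) (w : C -> C) : Prop :=
  forall z, 0 < Cmod z -> Cmod z < rho -> ex_cderive w z.

Lemma two_PI_pos : 0 < 2 * PI.
Proof. pose proof PI_RGT_0; lra. Qed.

Lemma Cmod_circ (r t : R) : 0 <= r -> Cmod (circ r t) = r.
Proof.
intros hr; unfold circ, Cmod; simpl.
replace (_ + _) with (r² * ((sin t)² + (cos t)²)) by (unfold Rsqr; ring).
rewrite sin2_cos2, Rmult_1_r; apply sqrt_Rsqr, hr.
Qed.

Lemma Csum_O (f : nat -> C) : Csum f 0 = f 0%nat.
Proof. apply (sum_O (G := C_AbelianMonoid)). Qed.

Lemma Csum_S (f : nat -> C) (n : nat) : Csum f (S n) = (Csum f n + f (S n))%C.
Proof. apply (sum_Sn (G := C_AbelianMonoid)). Qed.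

Lemma is_cmean_eq (w : C -> C) (r : R) (m m' : C) :
  is_cmean w r m -> m = m' -> is_cmean w r m'.
Proof. intros H <-; exact H. Qed.

Lemma is_cmean_ext (w w' : C -> C) (r : R) (m : C) :
  0 <= r -> (forall z, Cmod z = r -> w z = w' z) -> is_cmean w r m -> is_cmean w' r m.
Proof.
intros hr H; apply (is_RInt_ext (V := C_R_NormedModule)).
intros t _; apply H, Cmod_circ, hr.
Qed.

Lemma is_cmean_unique (w : C -> C) (r : R) (m m' : C) :
  is_cmean w r m -> is_cmean w r m' -> m = m'.
Proof.
intros h1%is_CInt_unique h2%is_CInt_unique.
rewrite h1 in h2; pose proof two_PI_pos.
assert (h0 : RtoC (2 * PI) <> 0%C) by (intros E; injection E; lra).
replace m with (/ RtoC (2 * PI) * (RtoC (2 * PI) * m))%C by (field; exact h0).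
rewrite h2; field; exact h0.
Qed.

Lemma is_cmean_plus (w w' : C -> C) (r : R) (m m' : C) :
  is_cmean w r m -> is_cmean w' r m' -> is_cmean (fun z => w z + w' z)%C r (m + m')%C.
Proof. intros h1 h2; unfold is_cmean; rewrite Cmult_plus_distr_l; apply is_CInt_plus; assumption. Qed.

Lemma is_cmean_scal (c : C) (w : C -> C) (r : R) (m : C) :
  is_cmean w r m -> is_cmean (fun z => c * w z)%C r (c * m)%C.
Proof.
intros h; unfold is_cmean; replace (RtoC (2 * PI) * (c * m))%C with (c * (RtoC (2 * PI) * m))%C by ring.
apply (is_CInt_scal c (fun t => w (circ r t))), h.
Qed.

Lemma is_cmean_minus (w w' : C -> C) (r : R) (m m' : C) :
  is_cmean w r m -> is_cmean w' r m' -> is_cmean (fun z => w z - w' z)%C r (m - m')%C.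
Proof.
intros h1 h2; unfold is_cmean.
replace (RtoC (2 * PI) * (m - m'))%C with (RtoC (2 * PI) * m - RtoC (2 * PI) * m')%C by ring.
apply is_CInt_minus; assumption.
Qed.

Lemma is_cmean_const (c : C) (r : R) : is_cmean (fun _ => c) r c.
Proof.
pose proof (is_CInt_affine c 0 0 (2 * PI)) as H.
unfold is_cmean; replace (RtoC (2 * PI) * c)%C
  with (c * (RtoC (2 * PI) - RtoC 0) + RtoC 0 * ((RtoC (2 * PI) * RtoC (2 * PI) - RtoC 0 * RtoC 0) / 2))%C
  by field.
apply (is_RInt_ext (V := C_R_NormedModule) (fun t => c + 0 * RtoC t)%C); [|exact H].
intros t _; change ((c + 0 * RtoC t)%C = c); ring.
Qed.

Lemma is_cmean_conj (w : C -> C) (r : R) (m : C) :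
  is_cmean w r m -> is_cmean (fun z => Cconj (w z)) r (Cconj m).
Proof.
intros [h1 h2]%is_CInt_pair; apply is_CInt_pair.
change (Re (Cconj ?z)) with (Re z); split.
- replace (Re (RtoC (2 * PI) * Cconj m)) with (Re (RtoC (2 * PI) * m)) by (destruct m; unfold Cconj, Re, Cmult; simpl; ring); exact h1.
- replace (Im (RtoC (2 * PI) * Cconj m)) with (- Im (RtoC (2 * PI) * m)) by (destruct m; unfold Cconj, Im, Cmult; simpl; ring).
  apply (is_RInt_opp (V := R_NormedModule)), h2.
Qed.

Lemma Cmod_is_cmean_le (w h : C -> C) (r : R) (m k : C) :
  0 <= r -> (forall z, Cmod z = r -> Cmod (w z) <= Re (h z)) ->
  is_cmean w r m -> is_cmean h r k -> Cmod m <= Re k.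
Proof.
intros hr H hw [hh _]%is_CInt_pair; pose proof two_PI_pos as hpi.
apply Rmult_le_reg_l with (2 * PI); [exact hpi|].
replace (2 * PI * Re k) with (Re (RtoC (2 * PI) * k)) by (destruct k; unfold Re, Cmult; simpl; ring).
replace (2 * PI * Cmod m) with (Cmod (RtoC (2 * PI) * m))
  by (rewrite Cmod_mult, Cmod_R, Rabs_pos_eq; lra).
apply (Cmod_is_CInt_le (fun t => w (circ r t)) (fun t => Re (h (circ r t))) 0 (2 * PI)); [lra| |exact hw|exact hh].
intros t _; apply H, Cmod_circ, hr.
Qed.

Lemma Cmod_is_cmean_le_const (w : C -> C) (r K : R) (m : C) :
  0 <= r -> (forall z, Cmod z = r -> Cmod (w z) <= K) -> is_cmean w r m -> Cmod m <= K.
Proof.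
intros hr H hw; apply (Cmod_is_cmean_le w (fun _ => RtoC K) r m (RtoC K) hr H hw).
apply is_cmean_const.
Qed.

Lemma Cexp_circ (x t : R) : Cexp (x, t) = circ (exp x) t.
Proof. reflexivity. Qed.

(** In the coordinate [log z] an annulus becomes a strip and [w] a function of
    period [2 * PI] in the vertical direction.  The horizontal sides of a
    rectangle of height [2 * PI] cancel, so Goursat's theorem equates the two
    vertical ones. *)
Lemma is_cmean_radius_lt (rho : R) (w : C -> C) (r r' : R) :
  holomorphic_punctured rho w -> 0 < r -> r < r' -> r' < rho ->
  exists m, is_cmean w r m /\ is_cmean w r' m.
Proof.
intros hw hr hr' h1; pose proof two_PI_pos as hpi.
set (v := fun z => w (Cexp z)).
assert (hx : ln r < ln r') by (apply ln_increasing; assumption).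
assert (hD : diff_on_rect v (ln r) (ln r' - ln r) 0 (2 * PI)).
{ intros p q hp _.
  assert (hp1 : exp p <= r').
  { rewrite <- (exp_ln r') by lra; destruct (Req_dec p (ln r')) as [->|hne]; [lra|].
    left; apply exp_increasing; lra. }
  destruct (hw (Cexp (p, q))) as [l hl].
  - rewrite Cmod_Cexp; apply exp_pos.
  - rewrite Cmod_Cexp; simpl; lra.
  - eexists; exact (is_cderive_comp w Cexp (p, q) l _ hl (is_cderive_Cexp _)). }
pose proof (rect_int_0 v (ln r) (ln r' - ln r) 0 (2 * PI) ltac:(lra) hpi hD) as H0; unfold rect_int in H0.
replace (ln r + (ln r' - ln r)) with (ln r') in * by ring.
rewrite Rplus_0_l in H0.
assert (Ev : forall t, v (t, 2 * PI) = v (t, 0)).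
{ intros t; unfold v; f_equal; unfold Cexp; simpl.
  rewrite cos_2PI, sin_2PI, cos_0, sin_0; reflexivity. }
rewrite (RInt_ext (V := C_R_CompleteNormedModule) (fun t => v (t, 2 * PI)) (fun t => v (t, 0))) in H0
  by (intros; apply Ev).
set (I1 := CInt (fun t => v (ln r', t)) 0 (2 * PI)) in *.
set (I0 := CInt (fun t => v (ln r, t)) 0 (2 * PI)) in *.
set (J := CInt _ _ _) in H0.
assert (E : @eq C I1 I0).
{ replace I1 with (I0 + - Ci * (J - J + Ci * (I1 - I0)))%C; [rewrite H0; ring|].
  replace (I0 + - Ci * (J - J + Ci * (I1 - I0)))%C with (I0 - Ci * Ci * (I1 - I0))%C by ring.
  replace (Ci * Ci)%C with (- (1))%C; [ring|].
  unfold Ci, Cmult, Copp, RtoC; simpl; f_equal; ring. }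
assert (hpi0 : RtoC (2 * PI) <> 0%C) by (intros F; injection F; lra).
assert (hI : forall x, ln r <= x <= ln r' -> is_CInt (fun t => v (x, t)) 0 (2 * PI) (CInt (fun t => v (x, t)) 0 (2 * PI))).
{ intros x hx'; apply CInt_correct.
  apply (ex_CInt_vertical v (ln r) (ln r' - ln r) 0 (2 * PI)); (exact hD || lra). }
exists (/ RtoC (2 * PI) * I0)%C; unfold is_cmean.
assert (EI : @eq C (RtoC (2 * PI) * (/ RtoC (2 * PI) * I0))%C I0) by (field; exact hpi0).
rewrite EI; split.
- eapply (is_RInt_ext (V := C_R_NormedModule)); [|apply (hI (ln r)); lra].
  intros t _; unfold v; rewrite Cexp_circ, exp_ln by lra; reflexivity.
- rewrite <- E; eapply (is_RInt_ext (V := C_R_NormedModule)); [|apply (hI (ln r')); lra].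
  intros t _; unfold v; rewrite Cexp_circ, exp_ln by lra; reflexivity.
Qed.

Lemma is_cmean_radius (rho : R) (w : C -> C) (r r' : R) (m : C) :
  holomorphic_punctured rho w -> 0 < r < rho -> 0 < r' < rho -> is_cmean w r m -> is_cmean w r' m.
Proof.
intros hw hr hr' hm; destruct (Rtotal_order r r') as [h|[<-|h]]; [|exact hm|].
- destruct (is_cmean_radius_lt rho w r r') as [m' [h1 h2]]; try (assumption || lra).
  rewrite (is_cmean_unique _ _ _ _ hm h1); exact h2.
- destruct (is_cmean_radius_lt rho w r' r) as [m' [h1 h2]]; try (assumption || lra).
  rewrite (is_cmean_unique _ _ _ _ hm h2); exact h1.
Qed.

Lemma ex_cmean (rho : R) (w : C -> C) (r : R) :
  holomorphic_punctured rho w -> 0 < r < rho -> exists m, is_cmean w r m.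
Proof.
intros hw hr; destruct (is_cmean_radius_lt rho w (r / 2) r hw) as [m [_ h]]; try lra.
exists m; exact h.
Qed.

(** The mean does not depend on the radius, so it can be computed by shrinking
    the circle to the origin. *)
Lemma is_cmean_limit (rho : R) (w : C -> C) (L : C) (r : R) :
  holomorphic_punctured rho w ->
  (forall eps, 0 < eps -> exists delta, 0 < delta /\
     forall z, 0 < Cmod z -> Cmod z < delta -> Cmod (w z - L) <= eps) ->
  0 < r < rho -> is_cmean w r L.
Proof.
intros hw hL hr; destruct (ex_cmean rho w r hw hr) as [m hm].
apply (is_cmean_eq _ _ _ _ hm).
assert (H : Cmod (m - L) <= 0).
{ apply le_epsilon; intros eps he; rewrite Rplus_0_l.
  destruct (hL eps he) as [d [hd H]].
  set (r' := Rmin d rho / 2).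
  assert (hr' : 0 < r' < rho /\ r' < d).
  { assert (hrho : 0 < rho) by lra.
    pose proof (Rmin_l d rho); pose proof (Rmin_r d rho); pose proof (Rmin_pos d rho hd hrho).
    unfold r'; lra. }
  apply (Cmod_is_cmean_le_const (fun z => w z - L)%C r'); [lra| |].
  - intros z hz; apply H; lra.
  - apply is_cmean_minus; [|apply is_cmean_const].
    apply (is_cmean_radius rho w r r'); (assumption || lra). }
assert (E : (m - L)%C = 0%C) by (apply Cmod_eq_0; pose proof (Cmod_ge_0 (m - L)); lra).
replace m with (L + (m - L))%C by ring; rewrite E; ring.
Qed.

(** * Series and orders of vanishing *)

Definition csum_to (b : nat -> C) (l : C) : Prop :=
  forall eps, 0 < eps -> exists n0, forall n, (n0 <= n)%nat -> Cmod (Csum b n - l) < eps.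

Lemma is_series_csum_to (b : nat -> C) (l : C) :
  @is_series C_AbsRing C_NormedModule b l -> csum_to b l.
Proof.
intros H eps he.
destruct (proj1 (filterlim_locally (U := C_UniformSpace) _ l) H (mkposreal (eps / 2) ltac:(lra))) as [n0 hn].
exists n0; intros n hle; destruct (hn n hle) as [h1 h2]; simpl in h1, h2.
eapply Rle_lt_trans; [apply Cmod_le_Rabs|].
change (Rabs (Re (Csum b n - l)) < eps / 2) in h1.
change (Rabs (Im (Csum b n - l)) < eps / 2) in h2.
lra.
Qed.

Lemma pow_n_Cpow (z : C) (n : nat) : @pow_n C_AbsRing z n = (z ^ n)%C.
Proof. induction n as [|n IH]; [reflexivity|]. simpl; rewrite IH; reflexivity. Qed.

Lemma Csum_ext (f g : nat -> C) (n : nat) :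
  (forall i, (i <= n)%nat -> f i = g i) -> Csum f n = Csum g n.
Proof. apply (sum_n_ext_loc (G := C_AbelianMonoid)). Qed.

Lemma csum_to_ext (b c : nat -> C) (l : C) :
  (forall n, b n = c n) -> csum_to b l -> csum_to c l.
Proof.
intros H hb eps he; destruct (hb eps he) as [n0 hn]; exists n0; intros n hle.
rewrite <- (Csum_ext b c n) by auto; auto.
Qed.

Lemma is_pseries_csum_to (a : nat -> C) (z l : C) :
  @is_pseries C_AbsRing C_NormedModule a z l -> csum_to (fun j => a j * z ^ j)%C l.
Proof.
intros H%is_series_csum_to; revert H; apply csum_to_ext; intros n.
rewrite pow_n_Cpow; apply Cmult_comm.
Qed.

Lemma csum_to_minus (b c : nat -> C) (l m : C) (eps : R) :
  csum_to b l -> csum_to c m -> 0 < eps ->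
  exists n0, forall n, (n0 <= n)%nat -> Cmod ((Csum b n - Csum c n) - (l - m)) < eps.
Proof.
intros hb hc he.
destruct (hb (eps / 2) ltac:(lra)) as [n1 h1], (hc (eps / 2) ltac:(lra)) as [n2 h2].
exists (n1 + n2)%nat; intros n hn.
replace (Csum b n - Csum c n - (l - m))%C with ((Csum b n - l) + - (Csum c n - m))%C by ring.
eapply Rle_lt_trans; [apply Cmod_triangle|]; rewrite Cmod_opp.
specialize (h1 n ltac:(lia)); specialize (h2 n ltac:(lia)); lra.
Qed.

Lemma Csum_geometric (b : nat -> C) (M : R) (n : nat) :
  (forall j, Cmod (b j) <= M * (1 / 2) ^ j) -> Cmod (Csum b n) <= 2 * M.
Proof.
intros H; assert (hM : 0 <= M).
{ pose proof (H O) as h; simpl in h; pose proof (Cmod_ge_0 (b O)); lra. }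
assert (K : Cmod (Csum b n) <= 2 * M - M * (1 / 2) ^ n).
{ induction n as [|n IH].
  - rewrite Csum_O; pose proof (H O) as h; simpl in *; lra.
  - rewrite Csum_S; eapply Rle_trans; [apply Cmod_triangle|].
    pose proof (H (S n)) as h; simpl in *; lra. }
pose proof (pow_lt (1 / 2) n ltac:(lra)); assert (0 <= M * (1 / 2) ^ n) by (apply Rmult_le_pos; lra); lra.
Qed.

Lemma ex_csum_to_geometric (b : nat -> C) (M : R) :
  (forall j, Cmod (b j) <= M * (1 / 2) ^ j) -> exists l, csum_to b l.
Proof.
intros H.
destruct (ex_series_le (K := C_AbsRing) (V := C_CompleteNormedModule) b (fun j => M * (1 / 2) ^ j) H) as [l hl].
- apply (ex_series_scal (K := R_AbsRing) (V := R_NormedModule) M (fun j => (1 / 2) ^ j)).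
  apply ex_series_geom; rewrite Rabs_pos_eq; lra.
- exists l; apply is_series_csum_to, hl.
Qed.

Lemma Csum_split (f : nat -> C) (k n : nat) :
  Csum f (S k + n) = (Csum f k + Csum (fun j => f (S k + j)%nat) n)%C.
Proof.
induction n as [|n IH].
- rewrite Nat.add_0_r, Csum_S, Csum_O, Nat.add_0_r; reflexivity.
- rewrite Nat.add_succ_r, Csum_S, IH, Csum_S, Nat.add_succ_r; ring.
Qed.

Lemma Csum_Cmult_l (c : C) (f : nat -> C) (n : nat) :
  Csum (fun j => c * f j)%C n = (c * Csum f n)%C.
Proof.
induction n as [|n IH]; [rewrite !Csum_O|rewrite !Csum_S, IH]; ring.
Qed.

(** [w z = O (z ^ k)] at the origin.  Power series identities are only needed
    up to such an error, which avoids composing and inverting series. *)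
Definition vanishes (k : nat) (w : C -> C) : Prop :=
  exists K d, 0 <= K /\ 0 < d /\ forall z, Cmod z < d -> Cmod (w z) <= K * Cmod z ^ k.

Lemma vanishes_ext_ball (k : nat) (w w' : C -> C) (d : R) :
  0 < d -> (forall z, Cmod z < d -> w z = w' z) -> vanishes k w -> vanishes k w'.
Proof.
intros hd H [K [d' [hK [hd' h]]]]; exists K, (Rmin d d').
split; [exact hK|split; [apply Rmin_pos; assumption|]].
intros z hz; pose proof (Rmin_l d d'); pose proof (Rmin_r d d').
rewrite <- H by lra; apply h; lra.
Qed.

Lemma vanishes_ext (k : nat) (w w' : C -> C) :
  (forall z, w z = w' z) -> vanishes k w -> vanishes k w'.
Proof. intros H; apply (vanishes_ext_ball k w w' 1); [lra|auto]. Qed.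

Lemma vanishes_plus (k : nat) (w w' : C -> C) :
  vanishes k w -> vanishes k w' -> vanishes k (fun z => w z + w' z)%C.
Proof.
intros [K [d [hK [hd h]]]] [K' [d' [hK' [hd' h']]]]; exists (K + K'), (Rmin d d').
split; [lra|split; [apply Rmin_pos; assumption|]].
intros z hz; pose proof (Rmin_l d d'); pose proof (Rmin_r d d').
eapply Rle_trans; [apply Cmod_triangle|].
specialize (h z ltac:(lra)); specialize (h' z ltac:(lra)); lra.
Qed.

Lemma vanishes_mult (k l : nat) (w w' : C -> C) :
  vanishes k w -> vanishes l w' -> vanishes (k + l) (fun z => w z * w' z)%C.
Proof.
intros [K [d [hK [hd h]]]] [K' [d' [hK' [hd' h']]]]; exists (K * K'), (Rmin d d').
split; [apply Rmult_le_pos; assumption|split; [apply Rmin_pos; assumption|]].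
intros z hz; pose proof (Rmin_l d d'); pose proof (Rmin_r d d').
rewrite Cmod_mult, pow_add.
replace (K * K' * (Cmod z ^ k * Cmod z ^ l)) with (K * Cmod z ^ k * (K' * Cmod z ^ l)) by ring.
apply Rmult_le_compat; try apply Cmod_ge_0; [apply h|apply h']; lra.
Qed.

Lemma vanishes_minus (k : nat) (w w' : C -> C) :
  vanishes k w -> vanishes k w' -> vanishes k (fun z => w z - w' z)%C.
Proof.
intros h [K [d [hK [hd h']]]]; apply vanishes_plus; [exact h|].
exists K, d; split; [exact hK|split; [exact hd|]].
intros z hz; rewrite Cmod_opp; apply h', hz.
Qed.

Lemma vanishes_O (w : C -> C) (l : C) : is_cderive w (RtoC 0) l -> vanishes 0 w.
Proof.
intros H; destruct (is_cderive_continuous w _ l H 1 Rlt_0_1) as [d [hd h]].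
exists (Cmod (w 0%C) + 1), d; split; [pose proof (Cmod_ge_0 (w 0%C)); lra|split; [exact hd|]].
intros z hz; replace (w z) with ((w z - w 0) + w 0)%C by ring.
eapply Rle_trans; [apply Cmod_triangle|].
specialize (h z); replace (z - 0)%C with z in h by ring; specialize (h hz); simpl; lra.
Qed.

Lemma vanishes_1 (w : C -> C) (l : C) : is_cderive w (RtoC 0) l -> w 0%C = 0%C -> vanishes 1 w.
Proof.
intros H h0.
destruct (proj1 (is_cderive_eps _ _ _) H 1 Rlt_0_1) as [d [hd h]].
exists (Cmod l + 1), d; split; [pose proof (Cmod_ge_0 l); lra|split; [exact hd|]].
intros z hz; specialize (h z); rewrite h0 in h.
replace (z - 0)%C with z in h by ring; specialize (h hz).
replace (w z) with ((w z - 0 - l * z) + l * z)%C by ring.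
eapply Rle_trans; [apply Cmod_triangle|]; rewrite Cmod_mult; simpl; lra.
Qed.

Lemma vanishes_pow (j : nat) : vanishes j (fun z => z ^ j)%C.
Proof.
exists 1, 1; split; [lra|split; [lra|]]; intros z _; rewrite Cmod_pow; lra.
Qed.

Lemma vanishes_pow_comp (w : C -> C) (m : nat) :
  vanishes 1 w -> vanishes m (fun z => w z ^ m)%C.
Proof.
intros H; induction m as [|m IH].
- exists 1, 1; split; [lra|split; [lra|]]; intros z _; simpl; rewrite Cmod_1; lra.
- exact (vanishes_mult 1 m _ _ H IH).
Qed.

Lemma vanishes_const (c : C) : vanishes 0 (fun _ => c).
Proof.
exists (Cmod c), 1; split; [apply Cmod_ge_0|split; [lra|]]; intros z _; simpl; lra.
Qed.

Lemma vanishes_scal (k : nat) (c : C) (w : C -> C) :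
  vanishes k w -> vanishes k (fun z => c * w z)%C.
Proof. intros h; exact (vanishes_mult 0 k _ _ (vanishes_const c) h). Qed.

Lemma vanishes_sum (k : nat) (w : nat -> C -> C) (n : nat) :
  (forall i, (i <= n)%nat -> vanishes k (w i)) ->
  vanishes k (fun z => Csum (fun i => w i z) n).
Proof.
induction n as [|n IH]; intros H.
- apply (vanishes_ext k (w O)); [intros z; symmetry; apply Csum_O|apply H; lia].
- apply (vanishes_ext k (fun z => Csum (fun i => w i z) n + w (S n) z)%C);
    [intros z; symmetry; apply Csum_S|].
  apply vanishes_plus; [apply IH; intros i hi|]; apply H; lia.
Qed.

Lemma vanishes_weaken (k l : nat) (w : C -> C) :
  (l <= k)%nat -> vanishes k w -> vanishes l w.
Proof.
intros hlk [K [d [hK [hd h]]]]; exists K, (Rmin d 1).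
split; [exact hK|split; [apply Rmin_pos; lra|]].
intros z hz; pose proof (Rmin_l d 1); pose proof (Rmin_r d 1); pose proof (Cmod_ge_0 z).
eapply Rle_trans; [apply h; lra|]; apply Rmult_le_compat_l; [exact hK|].
replace k with (l + (k - l))%nat by lia; rewrite pow_add.
assert (Cmod z ^ (k - l) <= 1) by (rewrite <- (pow1 (k - l)); apply pow_incr; lra).
rewrite <- (Rmult_1_r (Cmod z ^ l)) at 2; apply Rmult_le_compat_l; [apply pow_le|]; lra.
Qed.

(** * Termwise differentiation of power series *)

Definition taylor (k : nat) (c : nat -> C) (w : C -> C) : Prop :=
  vanishes (S k) (fun z => w z - Csum (fun j => c j * z ^ j) k)%C.

Definition derivative_coefs (a : nat -> C) (j : nat) : C := (INR (S j) * a (S j))%C.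

(** Geometric growth of the coefficients and a radius of convergence that is
    merely positive: both pass to the derivative, with worse constants, so the
    notion can be iterated. *)
Definition expands (a : nat -> C) (f : C -> C) : Prop :=
  (exists K A, 0 <= K /\ 0 < A /\ forall n, Cmod (a n) <= K * A ^ n) /\
  exists rho, 0 < rho /\ forall z, Cmod z < rho -> csum_to (fun j => a j * z ^ j)%C (f z).

Lemma csum_to_bounded (b : nat -> C) (l : C) :
  csum_to b l -> exists M, forall n, Cmod (b n) <= M.
Proof.
intros H; destruct (H 1 Rlt_0_1) as [n0 hn].
assert (K : forall m, exists M, forall n, (n < m)%nat -> Cmod (b n) <= M).
{ induction m as [|m [M hM]]; [exists 0; intros; lia|].
  exists (Rmax M (Cmod (b m))); intros n hlt.
  destruct (Nat.eq_dec n m) as [->|hne]; [apply Rmax_r|].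
  eapply Rle_trans; [apply hM; lia|apply Rmax_l]. }
destruct (K (S n0)) as [M hM]; exists (Rmax M 2); intros n.
destruct (Nat.lt_ge_cases n (S n0)) as [h|h]; [eapply Rle_trans; [apply hM, h|apply Rmax_l]|].
apply Rle_trans with 2; [|apply Rmax_r].
destruct n as [|n]; [lia|].
replace (b (S n)) with ((Csum b (S n) - l) + - (Csum b n - l))%C by (rewrite Csum_S; ring).
eapply Rle_trans; [apply Cmod_triangle|]; rewrite Cmod_opp.
pose proof (hn (S n) ltac:(lia)); pose proof (hn n ltac:(lia)); lra.
Qed.

(** Convergence at [1 / 2] bounds the terms there, which is geometric growth
    with ratio [2]. *)
Lemma normalized_expands (f : C -> C) (a : nat -> C) :
  normalized_expansion f a -> expands a f.
Proof.
intros [_ [_ H]]; split.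
- assert (h2 : in_disk (RtoC (1 / 2))).
  { unfold in_disk; rewrite Cmod_R, Rabs_pos_eq; lra. }
  destruct (csum_to_bounded _ _ (is_pseries_csum_to _ _ _ (H _ h2))) as [M hM].
  exists M, 2; split; [eapply Rle_trans; [apply Cmod_ge_0|apply (hM O)]|split; [lra|]].
  intros n; specialize (hM n); rewrite Cmod_mult, Cmod_pow, Cmod_R, Rabs_pos_eq in hM by lra.
  pose proof (pow_lt 2 n ltac:(lra)) as hp.
  apply Rmult_le_compat_r with (r := 2 ^ n) in hM; [|lra].
  rewrite Rmult_assoc, <- Rpow_mult_distr in hM.
  replace (1 / 2 * 2) with 1 in hM by field; rewrite pow1 in hM; lra.
- exists 1; split; [lra|]; intros z hz; apply is_pseries_csum_to, H, hz.
Qed.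

Lemma Cmod_le_of_approx (x : C) (M : R) :
  (forall eps, 0 < eps -> exists y, Cmod (y - x) < eps /\ Cmod y <= M) -> Cmod x <= M.
Proof.
intros H; apply le_epsilon; intros eps he; destruct (H eps he) as [y [h1 h2]].
replace x with (y + - (y - x))%C by ring.
eapply Rle_trans; [apply Cmod_triangle|]; rewrite Cmod_opp; lra.
Qed.

Lemma expands_taylor (a : nat -> C) (f : C -> C) (k : nat) :
  expands a f -> taylor k a f.
Proof.
intros [[K [A [hK [hA ha]]]] [rho [hrho H]]].
assert (hA2 : 0 < / (2 * A)) by (apply Rinv_0_lt_compat; lra).
exists (2 * (K * A ^ S k)), (Rmin rho (/ (2 * A))).
assert (hAk : 0 < A ^ S k) by (apply pow_lt, hA).
split; [apply Rmult_le_pos; [lra|apply Rmult_le_pos; lra]|split; [apply Rmin_pos; assumption|]].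
intros z hz; pose proof (Rmin_l rho (/ (2 * A))); pose proof (Rmin_r rho (/ (2 * A))).
apply Cmod_le_of_approx; intros eps he.
destruct (H z ltac:(lra) eps he) as [n0 hn].
exists (Csum (fun j => a (S k + j)%nat * z ^ (S k + j))%C n0); split.
- specialize (hn (S k + n0)%nat ltac:(lia)); rewrite Csum_split in hn.
  replace (_ - _)%C with (Csum (fun j : nat => a j * z ^ j) k + Csum (fun j => a (S k + j)%nat * z ^ (S k + j)) n0 - f z)%C
    by ring; exact hn.
- rewrite Rmult_assoc; apply Csum_geometric; intros j.
  rewrite Cmod_mult, Cmod_pow, pow_add.
  apply Rle_trans with (K * A ^ (S k + j) * (Cmod z ^ S k * Cmod z ^ j)).
  { apply Rmult_le_compat_r; [|apply ha].
    apply Rmult_le_pos; apply pow_le, Cmod_ge_0. }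
  rewrite pow_add.
  replace (K * (A ^ S k * A ^ j) * (Cmod z ^ S k * Cmod z ^ j))
    with (K * A ^ S k * Cmod z ^ S k * (A * Cmod z) ^ j) by (rewrite Rpow_mult_distr; ring).
  apply Rmult_le_compat_l.
  { apply Rmult_le_pos; [apply Rmult_le_pos; lra|apply pow_le, Cmod_ge_0]. }
  apply pow_incr; split; [apply Rmult_le_pos; [lra|apply Cmod_ge_0]|].
  replace (1 / 2) with (A * / (2 * A)) by (field; lra).
  apply Rmult_le_compat_l; lra.
Qed.

(** The error of the first order expansion of [w ^ (n + 1)] about [z]. *)
Definition pow_rem (z w : C) (n : nat) : C :=
  (w ^ S n - z ^ S n - (w - z) * (INR (S n) * z ^ n))%C.

Lemma pow_rem_S (z w : C) (n : nat) :
  pow_rem z w (S n) = (w * pow_rem z w n + INR (S n) * (w - z) * (w - z) * z ^ n)%C.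
Proof.
unfold pow_rem; rewrite (S_INR (S n)), RtoC_plus, !Cpow_S; ring.
Qed.

Lemma INR_le_pow4 (n : nat) : INR (S n) <= 3 * 4 ^ n.
Proof.
induction n as [|n IH]; [simpl; lra|].
rewrite S_INR; pose proof (pow_R1_Rle 4 n ltac:(lra)); simpl pow; lra.
Qed.

Lemma INR_le_pow2 (n : nat) : INR (S n) <= 2 ^ n.
Proof.
induction n as [|n IH]; [simpl; lra|].
rewrite S_INR; pose proof (pow_R1_Rle 2 n ltac:(lra)); simpl pow; lra.
Qed.

(** Quadratic in [w - z], with a geometric constant; this is what makes the
    termwise errors summable. *)
Lemma Cmod_pow_rem (z w : C) (r : R) (n : nat) :
  0 < r -> Cmod z <= r -> Cmod w <= r ->
  r * Cmod (pow_rem z w n) <= Cmod (w - z) * Cmod (w - z) * (4 * r) ^ n.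
Proof.
intros hr hz hw; set (h := Cmod (w - z)); assert (hh : 0 <= h) by apply Cmod_ge_0.
induction n as [|n IH].
- replace (pow_rem z w 0) with (RtoC 0) by (unfold pow_rem; simpl; ring).
  rewrite Cmod_0, Rmult_0_r; simpl; rewrite Rmult_1_r; apply Rmult_le_pos; exact hh.
- rewrite pow_rem_S.
  apply Rle_trans with (r * (Cmod w * Cmod (pow_rem z w n) + INR (S n) * h * h * Cmod z ^ n)).
  { apply Rmult_le_compat_l; [lra|].
    eapply Rle_trans; [apply Cmod_triangle|].
    rewrite !Cmod_mult, Cmod_pow, Cmod_R, Rabs_pos_eq by apply pos_INR; fold h; lra. }
  assert (h1 : Cmod w * (r * Cmod (pow_rem z w n)) <= r * (h * h * (4 * r) ^ n)).
  { apply Rmult_le_compat; [apply Cmod_ge_0| |exact hw|exact IH].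
    apply Rmult_le_pos; [lra|apply Cmod_ge_0]. }
  assert (hz' : Cmod z ^ n <= r ^ n) by (apply pow_incr; split; [apply Cmod_ge_0|exact hz]).
  assert (h2 : INR (S n) * Cmod z ^ n <= 3 * 4 ^ n * r ^ n).
  { apply Rmult_le_compat; [apply pos_INR|apply pow_le, Cmod_ge_0|apply INR_le_pow4|exact hz']. }
  assert (hhh : 0 <= h * h) by (apply Rmult_le_pos; exact hh).
  apply Rmult_le_compat_l with (r := r * (h * h)) in h2; [|apply Rmult_le_pos; lra].
  simpl pow; rewrite Rpow_mult_distr in *; lra.
Qed.

Lemma derived_geometric (a : nat -> C) (K A : R) (n : nat) :
  0 <= K -> 0 < A -> (forall n, Cmod (a n) <= K * A ^ n) ->
  Cmod (derivative_coefs a n) <= K * A * (2 * A) ^ n.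
Proof.
intros hK hA H; unfold derivative_coefs; rewrite Cmod_mult, Cmod_R, Rabs_pos_eq by apply pos_INR.
pose proof (pow_lt A n hA).
apply Rle_trans with (2 ^ n * (K * A ^ S n)).
- apply Rmult_le_compat; [apply pos_INR|apply Cmod_ge_0|apply INR_le_pow2|apply H].
- rewrite Rpow_mult_distr; simpl; lra.
Qed.

Lemma csum_to_derived (a : nat -> C) (K A : R) (z : C) :
  0 <= K -> 0 < A -> (forall n, Cmod (a n) <= K * A ^ n) -> Cmod z < / (8 * A) ->
  exists l, csum_to (fun j => derivative_coefs a j * z ^ j)%C l.
Proof.
intros hK hA ha hz; apply (ex_csum_to_geometric _ (K * A)); intros j.
rewrite Cmod_mult, Cmod_pow.
apply Rle_trans with (K * A * (2 * A) ^ j * Cmod z ^ j).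
- apply Rmult_le_compat_r; [apply pow_le, Cmod_ge_0|apply derived_geometric; assumption].
- rewrite Rmult_assoc, <- Rpow_mult_distr; apply Rmult_le_compat_l; [apply Rmult_le_pos; lra|].
  apply pow_incr; split; [apply Rmult_le_pos; [lra|apply Cmod_ge_0]|].
  apply Rle_trans with (2 * A * / (8 * A)); [apply Rmult_le_compat_l; lra|].
  replace (2 * A * / (8 * A)) with (1 / 4) by (field; lra); lra.
Qed.

(** Near the origin the termwise derivative converges to the derivative,
    because the errors [pow_rem] sum to a multiple of the square of [w - z]. *)
Lemma expands_derive (a : nat -> C) (f : C -> C) :
  expands a f -> expands (derivative_coefs a) (C_derive f) /\
    exists rho, 0 < rho /\ forall z, Cmod z < rho -> is_cderive f z (C_derive f z).
Proof.
intros [[K [A [hK [hA ha]]]] [rho [hrho H]]].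
(* With this radius the errors [pow_rem], multiplied by the coefficients,
   decrease with ratio [4 * A * r = 1 / 2]. *)
set (r := / (8 * A)).
assert (hr : 0 < r) by (apply Rinv_0_lt_compat; lra).
assert (hAr : 4 * A * r = 1 / 2) by (unfold r; field; lra).
assert (D : forall z, Cmod z < Rmin rho r -> forall l,
  csum_to (fun j => derivative_coefs a j * z ^ j)%C l -> is_cderive f z l).
{ intros z hz l hl; pose proof (Rmin_l rho r); pose proof (Rmin_r rho r).
  set (M := K * A * / r).
  assert (hM : 0 <= M).
  { repeat apply Rmult_le_pos; try lra; left; apply Rinv_0_lt_compat, hr. }
  apply is_cderive_eps; intros eps he.
  exists (Rmin (Rmin rho r - Cmod z) (eps / (2 * M + 1))); split.
  { apply Rmin_pos; [lra|apply Rdiv_lt_0_compat; lra]. }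
  intros w hw.
  pose proof (Rlt_le_trans _ _ _ hw (Rmin_l _ _)) as w1.
  pose proof (Rlt_le_trans _ _ _ hw (Rmin_r _ _)) as w2.
  assert (hwr : Cmod w < Rmin rho r).
  { replace w with (z + (w - z))%C by ring; pose proof (Cmod_triangle z (w - z)); lra. }
  set (h := Cmod (w - z)) in *; assert (hh : 0 <= h) by apply Cmod_ge_0.
  apply Rle_trans with (2 * (M * h * h)).
  - apply Cmod_le_of_approx; intros e hE.
    destruct (csum_to_minus _ _ _ _ (e / 2) (H w ltac:(lra)) (H z ltac:(lra)) ltac:(lra)) as [n1 h1].
    destruct (hl (e / 2 / (h + 1)) ltac:(apply Rdiv_lt_0_compat; lra)) as [n2 h2].
    set (n := (n1 + n2)%nat).
    exists (Csum (fun j => a (S j) * pow_rem z w j)%C n); split.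
    + specialize (h1 (S n) ltac:(unfold n; lia)); specialize (h2 n ltac:(unfold n; lia)).
      assert (E : Csum (fun j => a (S j) * pow_rem z w j)%C n =
        (Csum (fun j => a j * w ^ j) (S n) - Csum (fun j => a j * z ^ j) (S n)
         - (w - z) * Csum (fun j => derivative_coefs a j * z ^ j) n)%C).
      { clear. induction n as [|n IH].
        - rewrite !Csum_S, !Csum_O; unfold pow_rem, derivative_coefs; simpl; ring.
        - rewrite Csum_S, IH, (Csum_S _ (S n)), (Csum_S (fun j => a j * z ^ j)%C (S n)),
            (Csum_S (fun j => derivative_coefs a j * z ^ j)%C n).
          unfold pow_rem, derivative_coefs; ring. }
      rewrite E.
      match goal with |- Cmod ?x < _ => replace x with
        ((Csum (fun j => a j * w ^ j) (S n) - Csum (fun j => a j * z ^ j) (S n) - (f w - f z))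
         + - ((w - z) * (Csum (fun j => derivative_coefs a j * z ^ j) n - l)))%C by ring end.
      eapply Rle_lt_trans; [apply Cmod_triangle|].
      rewrite Cmod_opp, Cmod_mult; fold h.
      apply Rlt_le_trans with (e / 2 + e / 2); [|lra].
      apply Rplus_lt_le_compat; [exact h1|].
      apply Rle_trans with (h * (e / 2 / (h + 1))); [apply Rmult_le_compat_l; lra|].
      apply Rle_trans with ((h + 1) * (e / 2 / (h + 1))); [|right; field; lra].
      apply Rmult_le_compat_r; [|lra]; left; apply Rdiv_lt_0_compat; lra.
    + apply Csum_geometric; intros j; rewrite Cmod_mult.
      apply Rle_trans with (K * A ^ S j * (/ r * (h * h * (4 * r) ^ j))).
      { apply Rmult_le_compat; try apply Cmod_ge_0; [apply ha|].
        apply Rmult_le_reg_l with r; [exact hr|].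
        rewrite <- Rmult_assoc, Rinv_r, Rmult_1_l by lra.
        apply Cmod_pow_rem; lra. }
      rewrite <- hAr; replace ((4 * A * r) ^ j) with (A ^ j * (4 * r) ^ j)
        by (rewrite <- Rpow_mult_distr; f_equal; ring).
      right; unfold M; simpl; ring.
  - replace (2 * (M * h * h)) with (2 * M * h * h) by ring.
    apply Rmult_le_compat_r; [exact hh|].
    apply Rle_trans with (2 * M * (eps / (2 * M + 1))); [apply Rmult_le_compat_l; lra|].
    apply Rle_trans with ((2 * M + 1) * (eps / (2 * M + 1))); [|right; field; lra].
    apply Rmult_le_compat_r; [|lra]; left; apply Rdiv_lt_0_compat; lra. }
assert (E : forall z, Cmod z < Rmin rho r ->
  csum_to (fun j => derivative_coefs a j * z ^ j)%C (C_derive f z) /\ is_cderive f z (C_derive f z)).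
{ intros z hz; pose proof (Rmin_r rho r).
  destruct (csum_to_derived a K A z hK hA ha) as [l hl]; [fold r; lra|].
  pose proof (D z hz l hl) as hd; rewrite (is_C_derive_unique f z l hd); split; assumption. }
assert (hmin : 0 < Rmin rho r) by (apply Rmin_pos; assumption).
split; [split|].
- exists (K * A), (2 * A); split; [apply Rmult_le_pos; lra|split; [lra|]].
  intros n; apply derived_geometric; assumption.
- exists (Rmin rho r); split; [exact hmin|]; intros z hz; apply E, hz.
- exists (Rmin rho r); split; [exact hmin|]; intros z hz; apply E, hz.
Qed.

(** * Cauchy coefficients *)

Definition holomorphic_on_ball (rho : R) (u : C -> C) : Prop :=
  forall z, Cmod z < rho -> ex_cderive u z.

Lemma holomorphic_plus (rho : R) (u v : C -> C) :
  holomorphic_on_ball rho u -> holomorphic_on_ball rho v ->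
  holomorphic_on_ball rho (fun z => u z + v z)%C.
Proof.
intros hu hv z hz; destruct (hu z hz) as [l hl], (hv z hz) as [m hm].
eexists; exact (is_cderive_plus _ _ _ _ _ hl hm).
Qed.

Lemma holomorphic_minus (rho : R) (u v : C -> C) :
  holomorphic_on_ball rho u -> holomorphic_on_ball rho v ->
  holomorphic_on_ball rho (fun z => u z - v z)%C.
Proof.
intros hu hv z hz; destruct (hu z hz) as [l hl], (hv z hz) as [m hm].
eexists; exact (is_cderive_minus _ _ _ _ _ hl hm).
Qed.

Lemma holomorphic_mult (rho : R) (u v : C -> C) :
  holomorphic_on_ball rho u -> holomorphic_on_ball rho v ->
  holomorphic_on_ball rho (fun z => u z * v z)%C.
Proof.
intros hu hv z hz; destruct (hu z hz) as [l hl], (hv z hz) as [m hm].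
eexists; exact (is_cderive_mult _ _ _ _ _ hl hm).
Qed.

Lemma holomorphic_const (rho : R) (c : C) : holomorphic_on_ball rho (fun _ => c).
Proof. intros z _; eexists; apply is_cderive_const. Qed.

Lemma holomorphic_id (rho : R) : holomorphic_on_ball rho (fun z => z).
Proof. intros z _; eexists; apply is_cderive_id. Qed.

Lemma holomorphic_pow (rho : R) (u : C -> C) (n : nat) :
  holomorphic_on_ball rho u -> holomorphic_on_ball rho (fun z => u z ^ n)%C.
Proof.
intros hu z hz; destruct (hu z hz) as [l hl]; eexists; exact (is_cderive_pow _ n _ _ hl).
Qed.

Lemma holomorphic_div (rho : R) (u v : C -> C) :
  holomorphic_on_ball rho u -> holomorphic_on_ball rho v ->
  (forall z, Cmod z < rho -> v z <> 0%C) ->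
  holomorphic_on_ball rho (fun z => u z / v z)%C.
Proof.
intros hu hv h0; apply holomorphic_mult; [exact hu|]; intros z hz.
destruct (hv z hz) as [m hm]; eexists; exact (is_cderive_inv _ _ _ hm (h0 z hz)).
Qed.

Lemma holomorphic_sum (rho : R) (u : nat -> C -> C) (n : nat) :
  (forall i, holomorphic_on_ball rho (u i)) ->
  holomorphic_on_ball rho (fun z => Csum (fun i => u i z) n).
Proof.
intros H; induction n as [|n IH]; intros z hz.
- destruct (H O z hz) as [l hl]; exists l.
  refine (is_cderive_ext_ball _ _ _ _ 1 Rlt_0_1 _ hl).
  intros w _; symmetry; apply Csum_O.
- destruct (IH z hz) as [l hl], (H (S n) z hz) as [m hm]; exists (l + m)%C.
  refine (is_cderive_ext_ball _ _ _ _ 1 Rlt_0_1 _ (is_cderive_plus _ _ _ _ _ hl hm)).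
  intros w _; symmetry; apply Csum_S.
Qed.

Lemma holomorphic_poly (rho : R) (c : nat -> C) (n : nat) :
  holomorphic_on_ball rho (fun z => Csum (fun i => c i * z ^ i) n)%C.
Proof.
apply holomorphic_sum; intros i; apply holomorphic_mult; [apply holomorphic_const|].
apply (holomorphic_pow rho (fun z => z)), holomorphic_id.
Qed.

(** The Cauchy integral for the [k]-th coefficient of [u], for all radii at
    once.  It depends linearly on [u], it is bounded by the size of [u] near
    the boundary, and it kills functions vanishing to higher order at [0]. *)
Definition is_coef (rho : R) (u : C -> C) (k : nat) (m : C) : Prop :=
  forall r, 0 < r < rho -> is_cmean (fun z => u z / z ^ k)%C r m.

Lemma Cmod_pos_neq_0 (z : C) : 0 < Cmod z -> z <> 0%C.
Proof. apply Cmod_gt_0. Qed.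

Lemma punctured_div_pow (rho : R) (u : C -> C) (k : nat) :
  holomorphic_on_ball rho u -> holomorphic_punctured rho (fun z => u z / z ^ k)%C.
Proof.
intros hu z h0 hz; destruct (hu z hz) as [l hl].
assert (hk : (z ^ k)%C <> 0%C) by (apply Cpow_nz, Cmod_pos_neq_0, h0).
eexists; exact (is_cderive_mult _ _ _ _ _ hl
  (is_cderive_inv _ _ _ (is_cderive_pow (fun z => z) k z _ (is_cderive_id z)) hk)).
Qed.

Lemma ex_coef (rho : R) (u : C -> C) (k : nat) :
  0 < rho -> holomorphic_on_ball rho u -> exists m, is_coef rho u k m.
Proof.
intros hrho hu; pose proof (punctured_div_pow rho u k hu) as hp.
destruct (ex_cmean rho _ (rho / 2) hp ltac:(lra)) as [m hm].
exists m; intros r hr; apply (is_cmean_radius rho _ (rho / 2)); (assumption || lra).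
Qed.

Lemma is_coef_unique (rho : R) (u : C -> C) (k : nat) (m m' : C) :
  0 < rho -> is_coef rho u k m -> is_coef rho u k m' -> m = m'.
Proof.
intros hrho h h'; apply (is_cmean_unique (fun z => u z / z ^ k)%C (rho / 2)); [apply h|apply h']; lra.
Qed.

Lemma is_coef_ext (rho : R) (u v : C -> C) (k : nat) (m : C) :
  (forall z, 0 < Cmod z < rho -> u z = v z) -> is_coef rho u k m -> is_coef rho v k m.
Proof.
intros H h r hr; apply (is_cmean_ext (fun z => u z / z ^ k)%C); [lra| |apply h, hr].
intros z hz; rewrite H by lra; reflexivity.
Qed.

Lemma is_coef_plus (rho : R) (u v : C -> C) (k : nat) (m n : C) :
  is_coef rho u k m -> is_coef rho v k n -> is_coef rho (fun z => u z + v z)%C k (m + n)%C.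
Proof.
intros h h' r hr; apply (is_cmean_ext (fun z => u z / z ^ k + v z / z ^ k)%C); [lra| |].
- intros z hz; field; apply Cpow_nz, Cmod_pos_neq_0; lra.
- apply is_cmean_plus; [apply h, hr|apply h', hr].
Qed.

Lemma is_coef_scal (rho : R) (c : C) (u : C -> C) (k : nat) (m : C) :
  is_coef rho u k m -> is_coef rho (fun z => c * u z)%C k (c * m)%C.
Proof.
intros h r hr; apply (is_cmean_ext (fun z => c * (u z / z ^ k))%C); [lra| |].
- intros z hz; field; apply Cpow_nz, Cmod_pos_neq_0; lra.
- apply is_cmean_scal, h, hr.
Qed.

Lemma is_coef_minus (rho : R) (u v : C -> C) (k : nat) (m n : C) :
  is_coef rho u k m -> is_coef rho v k n -> is_coef rho (fun z => u z - v z)%C k (m - n)%C.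
Proof.
intros h h' r hr; apply (is_cmean_ext (fun z => u z / z ^ k - v z / z ^ k)%C); [lra| |].
- intros z hz; field; apply Cpow_nz, Cmod_pos_neq_0; lra.
- apply is_cmean_minus; [apply h, hr|apply h', hr].
Qed.

Lemma is_coef_sum (rho : R) (u : nat -> C -> C) (k : nat) (m : nat -> C) (n : nat) :
  (forall i, (i <= n)%nat -> is_coef rho (u i) k (m i)) ->
  is_coef rho (fun z => Csum (fun i => u i z) n) k (Csum m n).
Proof.
induction n as [|n IH]; intros H.
- rewrite Csum_O; apply (is_coef_ext rho (u O)); [intros z _; symmetry; apply Csum_O|apply H; lia].
- rewrite Csum_S; apply (is_coef_ext rho (fun z => Csum (fun i => u i z) n + u (S n) z)%C);
    [intros z _; symmetry; apply Csum_S|].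
  apply is_coef_plus; [apply IH; intros i hi|]; apply H; lia.
Qed.

(** Together with linearity this yields the Cauchy product of [u] with a
    polynomial. *)
Lemma is_coef_shift (rho : R) (u : C -> C) (j k : nat) (m : C) :
  (j <= k)%nat -> is_coef rho u (k - j) m -> is_coef rho (fun z => z ^ j * u z)%C k m.
Proof.
intros hj h r hr; apply (is_cmean_ext (fun z => u z / z ^ (k - j))%C); [lra| |apply h, hr].
intros z hz; assert (h0 : z <> 0%C) by (apply Cmod_pos_neq_0; lra).
replace (z ^ k)%C with (z ^ j * z ^ (k - j))%C
  by (rewrite <- Cpow_add_r; f_equal; lia).
field; split; apply Cpow_nz, h0.
Qed.

Lemma is_coef_vanishes (rho : R) (u : C -> C) (k : nat) :
  holomorphic_on_ball rho u -> vanishes (S k) u -> is_coef rho u k 0%C.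
Proof.
intros hu [K [d [hK [hd H]]]] r hr.
apply (is_cmean_limit rho); [apply punctured_div_pow, hu| |exact hr].
intros eps he; exists (Rmin d (eps / (K + 1))); split.
{ apply Rmin_pos; [exact hd|apply Rdiv_lt_0_compat; lra]. }
intros z h0 hz; pose proof (Rmin_l d (eps / (K + 1))); pose proof (Rmin_r d (eps / (K + 1))).
assert (hz0 : (z ^ k)%C <> 0%C) by (apply Cpow_nz, Cmod_pos_neq_0, h0).
replace (u z / z ^ k - 0)%C with (u z / z ^ k)%C by ring.
rewrite Cmod_div by exact hz0; rewrite Cmod_pow.
pose proof (pow_lt _ k h0) as hp.
apply Rmult_le_reg_r with (Cmod z ^ k); [exact hp|].
unfold Rdiv; rewrite Rmult_assoc, Rinv_l, Rmult_1_r by lra.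
eapply Rle_trans; [apply H; lra|]; simpl pow.
rewrite <- Rmult_assoc; apply Rmult_le_compat_r; [lra|].
apply Rle_trans with ((K + 1) * (eps / (K + 1))); [apply Rmult_le_compat; lra|right; field; lra].
Qed.

Lemma is_coef_const_0 (rho : R) (c : C) : is_coef rho (fun _ => c) 0 c.
Proof.
intros r hr; apply (is_cmean_ext (fun _ => c)); [lra| |apply is_cmean_const].
intros z _; simpl; field.
Qed.

Lemma Cmult_conj_circle (z : C) : (z * Cconj z)%C = RtoC (Cmod z * Cmod z).
Proof.
rewrite <- Cmod2_conj; unfold RtoC, Cpow; simpl.
unfold Cmult; simpl; f_equal; ring.
Qed.

(** On a circle [1 / z] is a positive multiple of the conjugate of [z].
    Conjugation therefore turns the mean of [u z * z ^ k], which vanishes for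
    [k >= 1], into a multiple of the mean below. *)
Lemma is_cmean_conj_div (rho : R) (u : C -> C) (k : nat) (r : R) :
  holomorphic_on_ball rho u -> (1 <= k)%nat -> 0 < r < rho ->
  is_cmean (fun z => Cconj (u z) / z ^ k)%C r 0%C.
Proof.
intros hu hk hr.
assert (h : is_coef rho (fun z => u z * z ^ k)%C 0 0%C).
{ apply is_coef_vanishes.
  - apply holomorphic_mult; [exact hu|apply (holomorphic_pow rho (fun z => z)), holomorphic_id].
  - destruct k as [|k]; [lia|].
    destruct (hu (RtoC 0)) as [l hl]; [rewrite Cmod_0; lra|].
    apply (vanishes_weaken (0 + S k)); [lia|].
    exact (vanishes_mult 0 (S k) _ _ (vanishes_O u l hl) (vanishes_pow (S k))). }
specialize (h r hr); apply is_cmean_conj in h.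
apply (is_cmean_scal (/ RtoC (r * r) ^ k)) in h.
assert (hrr : RtoC (r * r) <> 0%C).
{ intros E; injection E; intros E'; pose proof (Rmult_lt_0_compat r r); lra. }
eapply is_cmean_eq; [|apply (Cmult_0_r (/ RtoC (r * r) ^ k))].
replace (RtoC 0) with (Cconj 0) by (unfold Cconj, RtoC; simpl; f_equal; ring).
revert h; apply is_cmean_ext; [lra|]; intros z hz.
assert (h0 : z <> 0%C) by (apply Cmod_pos_neq_0; lra).
replace (u z * z ^ k / z ^ 0)%C with (u z * z ^ k)%C by (simpl; field).
rewrite Cmult_conj, Cpow_conj.
replace (RtoC (r * r)) with (z * Cconj z)%C by (rewrite Cmult_conj_circle, hz; reflexivity).
assert (hc : Cconj z <> 0%C) by (apply Cmod_pos_neq_0; rewrite Cmod_conj; lra).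
rewrite Cpow_mult_l; field; split; apply Cpow_nz; assumption.
Qed.

Lemma is_coef_const (rho : R) (c : C) (k : nat) :
  (1 <= k)%nat -> is_coef rho (fun _ => c) k 0%C.
Proof.
intros hk r hr.
refine (is_cmean_ext _ _ r _ _ _ (is_cmean_conj_div rho (fun _ => Cconj c) k r (holomorphic_const _ _) hk hr)).
- lra.
- intros z _; rewrite Cconj_conj; reflexivity.
Qed.

(** This links the integral to power series: the remainder vanishes to too
    high an order to contribute. *)
Lemma is_coef_taylor (rho : R) (u : C -> C) (c : nat -> C) (k : nat) :
  holomorphic_on_ball rho u -> taylor k c u -> is_coef rho u k (c k).
Proof.
intros hu ht.
apply (is_coef_ext rho (fun z => (u z - Csum (fun j => c j * z ^ j) k)
  + Csum (fun j => c j * z ^ j) k)%C); [intros; ring|].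
replace (c k) with (0 + c k)%C by ring.
apply is_coef_plus.
- apply is_coef_vanishes; [|exact ht].
  apply holomorphic_minus; [exact hu|apply holomorphic_poly].
- destruct k as [|k].
  + apply (is_coef_ext rho (fun _ => c O)); [intros z _; rewrite Csum_O; simpl; ring|apply is_coef_const_0].
  + assert (hm : forall j, (j <= S k)%nat ->
      is_coef rho (fun z => c j * z ^ j)%C (S k) (if Nat.eqb j (S k) then c j else 0%C)).
    { intros j hj.
      apply (is_coef_ext rho (fun z => z ^ j * c j)%C); [intros; ring|].
      apply is_coef_shift; [exact hj|].
      destruct (Nat.eqb_spec j (S k)) as [->|hne].
      - rewrite Nat.sub_diag; apply is_coef_const_0.
      - apply is_coef_const; lia. }
    apply is_coef_sum in hm.
    replace (c (S k)) with (Csum (fun j => if Nat.eqb j (S k) then c j else 0%C) (S k)); [exact hm|].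
    rewrite Csum_S, Nat.eqb_refl.
    rewrite (Csum_ext _ (fun j => RtoC 0 * RtoC 0)%C k).
    * rewrite Csum_Cmult_l; ring.
    * intros i hi; destruct (Nat.eqb_spec i (S k)); [lia|ring].
Qed.

(** * Caratheodory's inequality *)

Lemma pow_one_minus_ge (d : R) (k : nat) : 0 <= d <= 1 -> 1 - INR k * d <= (1 - d) ^ k.
Proof.
intros hd; induction k as [|k IH]; [simpl; lra|].
rewrite S_INR; simpl pow; pose proof (pos_INR k).
apply Rmult_le_compat_l with (r := 1 - d) in IH; [|lra].
assert (0 <= INR k * (d * d)) by (apply Rmult_le_pos; [lra|apply Rmult_le_pos; lra]); lra.
Qed.

(** Lets the radius of a Cauchy estimate tend to [1]. *)
Lemma le_of_pow_le (x y : R) (k : nat) :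
  0 <= x -> (forall r, 0 < r < 1 -> x * r ^ k <= y) -> x <= y.
Proof.
intros hx H; apply le_epsilon; intros eps he.
pose proof (pos_INR k) as hk.
assert (hkx : 0 <= INR k * x) by (apply Rmult_le_pos; lra).
(* By Bernoulli's inequality the radius [1 - d] loses at most [eps]. *)
set (d := Rmin (1 / 2) (eps / (INR k * x + 1))).
assert (hd : 0 < d <= 1 / 2).
{ split; [apply Rmin_pos; [lra|apply Rdiv_lt_0_compat; lra]|apply Rmin_l]. }
assert (hd2 : INR k * x * d <= eps).
{ apply Rle_trans with ((INR k * x + 1) * (eps / (INR k * x + 1))).
  - apply Rmult_le_compat; try lra; apply Rmin_r.
  - right; field; lra. }
specialize (H (1 - d) ltac:(lra)); pose proof (pow_one_minus_ge d k ltac:(lra)) as hp.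
apply Rmult_le_compat_l with (r := x) in hp; lra.
Qed.

Lemma Cplus_conj_Re (z : C) : (z + Cconj z)%C = RtoC (2 * Re z).
Proof. unfold Cplus, Cconj, RtoC; simpl; f_equal; unfold Re; ring. Qed.

(** The conjugate of [h] contributes nothing to a coefficient of positive
    index, so [h] may be replaced by [2 * Re h], which is nonnegative and has
    mean [2]. *)
Lemma caratheodory (h : C -> C) (k : nat) (m : C) :
  holomorphic_on_ball 1 h -> (forall z, Cmod z < 1 -> 0 <= Re (h z)) -> h 0%C = 1%C ->
  (1 <= k)%nat -> is_coef 1 h k m -> Cmod m <= 2.
Proof.
intros hh hre h0 hk hm; apply (le_of_pow_le _ _ k); [apply Cmod_ge_0|]; intros r hr.
pose proof (pow_lt r k ltac:(lra)) as hp.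
assert (mean : is_cmean h r 1%C).
{ refine (is_cmean_ext (fun z => h z / z ^ 0)%C _ r _ _ _ _); [lra|intros z _; simpl; field|].
  rewrite <- h0; apply (is_coef_taylor 1 h (fun _ => h 0%C) 0 hh); [|lra].
  destruct (hh (RtoC 0)) as [l hl]; [rewrite Cmod_0; lra|].
  apply (vanishes_ext 1 (fun z => h z - h 0)%C); [intros z; rewrite Csum_O; simpl; ring|].
  apply (vanishes_1 _ (l - 0)%C); [|ring].
  apply is_cderive_minus; [exact hl|apply is_cderive_const]. }
assert (L : Cmod m <= 2 / r ^ k).
{ replace (2 / r ^ k) with (Re (RtoC (2 / r ^ k) * 1)%C) by (simpl; ring).
  replace m with (m + 0)%C by ring.
  apply (Cmod_is_cmean_le (fun z => h z / z ^ k + Cconj (h z) / z ^ k)%C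
           (fun z => RtoC (2 / r ^ k) * h z)%C r); [lra| | |].
  - intros z hz; assert (hz0 : (z ^ k)%C <> 0%C) by (apply Cpow_nz, Cmod_pos_neq_0; lra).
    replace (h z / z ^ k + Cconj (h z) / z ^ k)%C with ((h z + Cconj (h z)) / z ^ k)%C
      by (field; exact hz0).
    rewrite Cplus_conj_Re, Cmod_div, Cmod_R, Cmod_pow, hz by exact hz0.
    specialize (hre z ltac:(lra)); rewrite Rabs_pos_eq by lra.
    right; unfold Re, Cmult; simpl; field; lra.
  - apply is_cmean_plus; [apply hm, hr|apply (is_cmean_conj_div 1); assumption].
  - apply is_cmean_scal, mean. }
apply Rmult_le_compat_r with (r := r ^ k) in L; [|lra].
replace (2 / r ^ k * r ^ k) with 2 in L by (field; lra); exact L.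
Qed.

Lemma Re_cayley (x : C) : Cmod x < 1 -> 0 <= Re ((1 + x) / (1 - x))%C.
Proof.
intros hx; pose proof (Cmod2_alt x) as E.
pose proof (Cmod_ge_0 x).
assert (h1 : Cmod x ^ 2 < 1) by (simpl; rewrite Rmult_1_r; rewrite <- (Rmult_1_r 1); apply Rmult_le_0_lt_compat; lra).
rewrite E in h1; pose proof (Re_one_minus_disk x hx) as hre.
destruct x as [a b]; unfold Re, Im in *; simpl in *.
assert (hd : 0 < (1 - a) * (1 - a) + b * b).
{ pose proof (Rmult_lt_0_compat (1 - a) (1 - a)); pose proof (Rle_0_sqr b); unfold Rsqr in *; lra. }
match goal with |- 0 <= ?t => replace t with ((1 - a * a - b * b) / ((1 - a) * (1 - a) + b * b)) end.
- apply Rmult_le_pos; [lra|left; apply Rinv_0_lt_compat, hd].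
- field; intros F; lra.
Qed.

(** The geometric series with its remainder, which is [O (x ^ (n + 2))]. *)
Lemma cayley_expansion (x : C) (n : nat) : (1 - x)%C <> 0%C ->
  ((1 + x) / (1 - x) = 1 + 2 * Csum (fun j => x ^ S j) n + x ^ S (S n) * (2 / (1 - x)))%C.
Proof.
intros h; induction n as [|n IH].
- rewrite Csum_O; simpl; field; exact h.
- rewrite Csum_S, IH, (Cpow_S x (S (S n))); field; exact h.
Qed.

Section Subordination.

Variable om : C -> C.
Hypotheses (hom : holomorphic_on_ball 1 om) (hom0 : om 0%C = 0%C)
  (hom1 : forall z, Cmod z < 1 -> Cmod (om z) < 1).

Lemma om_vanishes : vanishes 1 om.
Proof.
destruct (hom (RtoC 0)) as [l hl]; [rewrite Cmod_0; lra|].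
exact (vanishes_1 om l hl hom0).
Qed.

(** The functions [(1 + x * om) / (1 - x * om)] have nonnegative real part, and
    their coefficient of index [n + 1] is [2 * x] times the polynomial below.
    Caratheodory's inequality bounds it for all [x] on the unit circle. *)
Lemma power_coefs_bound (n : nat) (tau : nat -> C) (x : C) :
  (forall j, is_coef 1 (fun z => om z ^ S j)%C (S n) (tau j)) -> Cmod x = 1 ->
  Cmod (Csum (fun j => tau j * x ^ j)%C n) <= 1.
Proof.
intros htau hx.
assert (hxom : forall z, Cmod z < 1 -> Cmod (x * om z) < 1).
{ intros z hz; rewrite Cmod_mult, hx, Rmult_1_l; apply hom1, hz. }
assert (hne : forall z, Cmod z < 1 -> (1 - x * om z)%C <> 0%C).
{ intros z hz; apply one_minus_disk_neq_0, hxom, hz. }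
assert (hol1 : holomorphic_on_ball 1 (fun z => x * om z)%C)
  by (apply holomorphic_mult; [apply holomorphic_const|exact hom]).
assert (hol2 : holomorphic_on_ball 1 (fun z => 1 - x * om z)%C)
  by (apply holomorphic_minus; [apply holomorphic_const|exact hol1]).
set (h := fun z => ((1 + x * om z) / (1 - x * om z))%C).
assert (holh : holomorphic_on_ball 1 h).
{ apply holomorphic_div; [|exact hol2|exact hne].
  apply holomorphic_plus; [apply holomorphic_const|exact hol1]. }
assert (van : vanishes 1 (fun z => x * om z)%C) by (apply vanishes_scal, om_vanishes).
assert (hrem : is_coef 1 (fun z => (x * om z) ^ S (S n) * (2 / (1 - x * om z)))%C (S n) 0%C).
{ assert (hol3 : holomorphic_on_ball 1 (fun z => 2 / (1 - x * om z))%C)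
    by (apply holomorphic_div; [apply holomorphic_const|exact hol2|exact hne]).
  apply is_coef_vanishes.
  - apply holomorphic_mult; [apply (holomorphic_pow 1 (fun z => x * om z)%C), hol1|exact hol3].
  - replace (S (S n)) with (S (S n) + 0)%nat at 1 by lia.
    destruct (hol3 (RtoC 0)) as [l hl]; [rewrite Cmod_0; lra|].
    apply (vanishes_mult (S (S n)) 0 (fun z => (x * om z) ^ S (S n))%C);
      [apply (vanishes_pow_comp (fun z => x * om z)%C), van|exact (vanishes_O _ l hl)]. }
set (m := (x * Csum (fun j => tau j * x ^ j)%C n)%C).
assert (hcoef : is_coef 1 h (S n) (2 * m)%C).
{ apply (is_coef_ext 1 (fun z => 1 + 2 * Csum (fun j => x ^ S j * om z ^ S j) n
     + (x * om z) ^ S (S n) * (2 / (1 - x * om z)))%C).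
  { intros z hz; unfold h; rewrite (cayley_expansion _ n) by (apply hne; lra).
    do 3 f_equal; apply Csum_ext; intros i _; rewrite Cpow_mult_l; reflexivity. }
  replace (2 * m)%C with (0 + 2 * m + 0)%C by ring.
  apply is_coef_plus; [|exact hrem].
  apply is_coef_plus; [apply is_coef_const; lia|].
  apply is_coef_scal.
  replace m with (Csum (fun j => x ^ S j * tau j)%C n).
  - apply (is_coef_sum 1 (fun j z => x ^ S j * om z ^ S j)%C).
    intros j _; apply is_coef_scal, htau.
  - unfold m; rewrite <- Csum_Cmult_l; apply Csum_ext; intros i _; rewrite Cpow_S; ring. }
apply caratheodory in hcoef; [|exact holh| | |lia].
- rewrite Cmod_mult, Cmod_R, Rabs_pos_eq in hcoef by lra.
  unfold m in hcoef; rewrite Cmod_mult, hx in hcoef; lra.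
- intros z hz; apply Re_cayley, hxom, hz.
- unfold h; rewrite hom0; field; intros F; injection F; lra.
Qed.

End Subordination.

(** * Fejer sums and convex weights *)

Definition geom (n : nat) (z : C) : C := Csum (fun i => z ^ i)%C n.

Lemma geom_closed (n : nat) (z : C) : ((1 - z) * geom n z = 1 - z ^ S n)%C.
Proof.
unfold geom; induction n as [|n IH].
- rewrite Csum_O; simpl; ring.
- rewrite Csum_S, Cmult_plus_distr_l, IH, (Cpow_S z (S n)); ring.
Qed.

Lemma geom_S (n : nat) (z : C) : (geom (S n) z = 1 + z * geom n z)%C.
Proof.
unfold geom; induction n as [|n IH].
- rewrite Csum_S, !Csum_O; simpl; ring.
- rewrite (Csum_S _ (S n)), IH at 1; rewrite (Csum_S _ n), (Cpow_S z (S n)); ring.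
Qed.

(** Multiplying by [1 - z] telescopes the partial sums. *)
Lemma partial_sums_closed (c : nat -> C) (n : nat) (z : C) :
  ((1 - z) * Csum (fun i => Csum c i * z ^ i) n
   = Csum (fun i => c i * z ^ i) n - Csum c n * z ^ S n)%C.
Proof.
induction n as [|n IH].
- rewrite !Csum_O; simpl; ring.
- rewrite !(Csum_S _ n), Cmult_plus_distr_l, IH, (Cpow_S z (S n)); ring.
Qed.

Lemma holomorphic_geom (rho : R) (n : nat) : holomorphic_on_ball rho (geom n).
Proof.
apply (holomorphic_sum rho (fun i z => z ^ i)%C); intros i.
apply (holomorphic_pow rho (fun z => z)), holomorphic_id.
Qed.

Lemma vanishes_holomorphic (rho : R) (u : C -> C) :
  0 < rho -> holomorphic_on_ball rho u -> vanishes 0 u.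
Proof.
intros hr hu; destruct (hu (RtoC 0)) as [l hl]; [rewrite Cmod_0; lra|].
exact (vanishes_O u l hl).
Qed.

(** [1 + z + ... + z ^ n] is [1 / (1 - z)] up to order [n], and multiplication
    by the latter sums the coefficients. *)
Lemma taylor_mult_geom (n : nat) (c : nat -> C) (u : C -> C) :
  taylor n c u -> taylor n (Csum c) (fun z => u z * geom n z)%C.
Proof.
intros H; set (P := fun z => Csum (fun i => c i * z ^ i)%C n).
set (S' := fun z => Csum (fun i => Csum c i * z ^ i)%C n).
assert (hg := vanishes_holomorphic 1 _ Rlt_0_1 (holomorphic_geom 1 n)).
assert (hS : vanishes 0 S') by (apply (vanishes_holomorphic 1 _ Rlt_0_1), holomorphic_poly).
apply (vanishes_ext _ (fun z => geom n z * (u z - P z) + z ^ S n * (Csum c n * geom n z - S' z))%C).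
- intros z; fold (S' z).
  assert (E : P z = ((1 - z) * S' z + Csum c n * z ^ S n)%C)
    by (unfold S', P; rewrite partial_sums_closed; ring).
  rewrite E; pose proof (geom_closed n z) as G.
  transitivity (geom n z * u z - S' z * (((1 - z) * geom n z) + z ^ S n))%C; [ring|rewrite G; ring].
- apply vanishes_plus.
  + apply (vanishes_mult 0 (S n) _ _ hg H).
  + replace (S n) with (S n + 0)%nat at 1 by lia.
    apply (vanishes_mult (S n) 0 _ _ (vanishes_pow (S n))).
    apply vanishes_minus; [apply vanishes_scal, hg|exact hS].
Qed.

Lemma taylor_poly (c : nat -> C) (n N : nat) :
  (n <= N)%nat -> taylor n c (fun z => Csum (fun j => c j * z ^ j) N)%C.
Proof.
intros hn; unfold taylor.
destruct (Nat.eq_dec n N) as [->|hne].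
- apply (vanishes_ext _ (fun z => 0 * z ^ S N)%C); [intros; ring|].
  apply vanishes_scal, vanishes_pow.
- apply (vanishes_ext _ (fun z => Csum (fun j => c (S n + j)%nat * z ^ (S n + j)) (N - S n))%C).
  + intros z; replace N with (S n + (N - S n))%nat at 2 by lia; rewrite Csum_split; ring.
  + apply (vanishes_sum _ (fun j z => c (S n + j)%nat * z ^ (S n + j))%C); intros j _.
    apply vanishes_scal, (vanishes_weaken (S n + j)); [lia|apply vanishes_pow].
Qed.

(** Conjugation on the unit circle reverses the order of the powers. *)
Lemma geom_conj (n : nat) (z : C) : Cmod z = 1 -> (z ^ n * Cconj (geom n z) = geom n z)%C.
Proof.
intros hz; assert (hc : (z * Cconj z = 1)%C) by (rewrite Cmult_conj_circle, hz, Rmult_1_r; reflexivity).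
induction n as [|n IH].
- unfold geom; rewrite !Csum_O; simpl; unfold Cconj, Cmult, RtoC; simpl; f_equal; ring.
- rewrite geom_S at 2; rewrite <- IH.
  unfold geom at 1; rewrite Csum_S; fold (geom n z).
  rewrite Cplus_conj, Cpow_conj, (Cpow_S z n).
  replace (z * z ^ n * (Cconj (geom n z) + Cconj z ^ S n))%C
    with (z * (z ^ n * Cconj (geom n z)) + (z * z ^ n) * Cconj z ^ S n)%C by ring.
  rewrite <- (Cpow_S z n), <- Cpow_mult_l, hc, Cpow_1_l; ring.
Qed.

(** The second partial sum of [T] is the coefficient of [z ^ n] in the product
    of the polynomial of [T] with [geom n z ^ 2].  On the unit circle
    [geom n z ^ 2 / z ^ n] is the square of the modulus of [geom n z], a
    nonnegative kernel of mean [n + 1]: averaging a function bounded by [1]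
    against it gives at most [n + 1]. *)
Lemma fejer_bound (T : nat -> C) (n N : nat) :
  (n <= N)%nat -> (forall x, Cmod x = 1 -> Cmod (Csum (fun j => T j * x ^ j)%C N) <= 1) ->
  Cmod (Csum (Csum T) n) <= INR (S n).
Proof.
intros hn H; set (u := fun z => Csum (fun j => T j * z ^ j)%C N).
assert (hg := holomorphic_geom 2 n).
assert (hu : holomorphic_on_ball 2 u) by apply holomorphic_poly.
assert (mT : is_coef 2 (fun z => u z * geom n z * geom n z)%C n (Csum (Csum T) n)).
{ apply is_coef_taylor.
  - apply (holomorphic_mult 2 (fun z => u z * geom n z)%C (geom n)); [apply (holomorphic_mult 2 u (geom n)); assumption|exact hg].
  - apply (taylor_mult_geom n _ (fun z => u z * geom n z)%C), taylor_mult_geom, taylor_poly, hn. }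
assert (mD : is_coef 2 (fun z => geom n z * geom n z)%C n (Csum (fun _ => 1) n)%C).
{ apply (is_coef_taylor 2 _ (Csum (fun _ => RtoC 1))).
  - apply (holomorphic_mult 2 (geom n) (geom n)); exact hg.
  - apply (taylor_mult_geom n (fun _ => RtoC 1)).
    apply (vanishes_ext _ (fun z => Csum (fun j => 1 * z ^ j) n - Csum (fun j => 1 * z ^ j) n)%C).
    + intros z; f_equal; apply Csum_ext; intros; ring.
    + apply taylor_poly; lia. }
assert (E1 : Csum (fun _ => RtoC 1) n = RtoC (INR (S n))).
{ clear; induction n as [|n IH]; [apply Csum_O|].
  rewrite Csum_S, (S_INR (S n)), RtoC_plus, IH; reflexivity. }
rewrite E1 in mD; change (INR (S n)) with (Re (RtoC (INR (S n)))).
apply (Cmod_is_cmean_le (fun z => u z * geom n z * geom n z / z ^ n)%C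
  (fun z => geom n z * geom n z / z ^ n)%C 1); [lra| |apply mT; lra|apply mD; lra].
intros z hz.
assert (hz0 : (z ^ n)%C <> 0%C) by (apply Cpow_nz, Cmod_pos_neq_0; lra).
assert (E : (geom n z * geom n z / z ^ n)%C = RtoC (Cmod (geom n z) * Cmod (geom n z))).
{ rewrite <- Cmult_conj_circle.
  transitivity (geom n z * (z ^ n * Cconj (geom n z)) / z ^ n)%C;
    [rewrite (geom_conj n z hz); reflexivity|field; exact hz0]. }
replace (u z * geom n z * geom n z / z ^ n)%C with (u z * (geom n z * geom n z / z ^ n))%C
  by (field; exact hz0).
rewrite E, Cmod_mult, Cmod_R.
assert (h0 : 0 <= Cmod (geom n z) * Cmod (geom n z)) by (apply Rmult_le_pos; apply Cmod_ge_0).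
rewrite Rabs_pos_eq by exact h0.
specialize (H z hz); change (Re (RtoC ?t)) with t.
rewrite <- (Rmult_1_l (Cmod (geom n z) * _)) at 2; apply Rmult_le_compat_r; assumption.
Qed.

Lemma abel_summation (e : nat -> R) (T : nat -> C) (M : nat) :
  (Csum (fun j => e j * T j) (S M)
   = e (S M) * Csum T (S M) + Csum (fun j => RtoC (e j - e (S j)) * Csum T j) M)%C.
Proof.
induction M as [|M IH].
- rewrite !Csum_S, !Csum_O; rewrite (RtoC_minus (e O)); ring.
- rewrite (Csum_S _ (S M)), IH, (Csum_S (fun j => RtoC (e j - e (S j)) * Csum T j)%C M),
    (Csum_S T (S M)), (RtoC_minus (e (S M))); ring.
Qed.

(** Abel summation expresses the left side through the partial sums of [T],
    with nonnegative factors; equality holds when [T] is constantly [1]. *)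
Lemma abel_bound (d : nat -> R) (T : nat -> C) (M : nat) :
  (forall j, 0 <= d j) -> (forall j, d (S j) <= d j) ->
  (forall j, (j <= M)%nat -> Cmod (Csum T j) <= INR (S j)) ->
  Cmod (Csum (fun j => d j * T j)%C M) <= sum_f_R0 d M.
Proof.
intros h0 h1 H; destruct M as [|M].
- rewrite Csum_O, Cmod_mult, Cmod_R, Rabs_pos_eq by apply h0; simpl.
  specialize (H O ltac:(lia)); rewrite Csum_O in H; simpl in H.
  rewrite <- (Rmult_1_r (d O)) at 2; apply Rmult_le_compat_l; [apply h0|exact H].
- rewrite abel_summation; eapply Rle_trans; [apply Cmod_triangle|].
  assert (K : forall m, (m <= M)%nat ->
    Cmod (Csum (fun j => RtoC (d j - d (S j)) * Csum T j)%C m)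
      <= sum_f_R0 d (S m) - d (S m) * INR (S (S m))).
  { induction m as [|m IH]; intros hm.
    - rewrite Csum_O, Cmod_mult, Cmod_R, Rabs_pos_eq by (specialize (h1 O); lra).
      specialize (H O ltac:(lia)); simpl in *.
      apply Rmult_le_compat_l with (r := d O - d 1%nat) in H; [lra|specialize (h1 O); lra].
    - rewrite Csum_S; eapply Rle_trans; [apply Cmod_triangle|].
      specialize (IH ltac:(lia)); specialize (H (S m) ltac:(lia)); specialize (h1 (S m)).
      rewrite Cmod_mult, Cmod_R, Rabs_pos_eq by lra.
      apply Rmult_le_compat_l with (r := d (S m) - d (S (S m))) in H; [|lra].
      rewrite tech5; rewrite (S_INR (S (S m))); lra. }
  specialize (K M ltac:(lia)); specialize (H (S M) ltac:(lia)).
  rewrite Cmod_mult, Cmod_R, Rabs_pos_eq by apply h0.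
  apply Rmult_le_compat_l with (r := d (S M)) in H; [lra|apply h0].
Qed.

(** Two Abel summations express the sum through the second partial sums of
    [T], where convexity makes the factors nonnegative.  [fejer_bound] applies
    to each of them, and the case [T = 1, 0, 0, ...] shows that the bounds add
    up to [e 0]. *)
Lemma convex_weights_bound (e : nat -> R) (T : nat -> C) (N : nat) :
  (forall j, 0 <= e j) -> (forall j, e (S j) <= e j) ->
  (forall j, e (S j) - e (S (S j)) <= e j - e (S j)) ->
  (forall x, Cmod x = 1 -> Cmod (Csum (fun j => T j * x ^ j)%C N) <= 1) ->
  Cmod (Csum (fun j => e j * T j)%C N) <= e O.
Proof.
intros h0 h1 h2 H.
assert (H1 : Cmod (Csum T N) <= 1).
{ specialize (H (RtoC 1) Cmod_1).
  rewrite (Csum_ext _ T) in H; [exact H|]; intros i _; rewrite Cpow_1_l; ring. }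
destruct N as [|M].
- rewrite Csum_O in *; rewrite Cmod_mult, Cmod_R, Rabs_pos_eq by apply h0.
  apply Rmult_le_compat_l with (r := e O) in H1; [lra|apply h0].
- rewrite abel_summation; eapply Rle_trans; [apply Cmod_triangle|].
  assert (K : Cmod (Csum (fun j => RtoC (e j - e (S j)) * Csum T j)%C M)
    <= sum_f_R0 (fun j => e j - e (S j)) M).
  { apply (abel_bound (fun j => e j - e (S j))).
    - intros j; specialize (h1 j); lra.
    - exact h2.
    - intros j hj; apply (fejer_bound T j (S M)); [lia|exact H]. }
  assert (E : sum_f_R0 (fun j => e j - e (S j)) M = e O - e (S M)).
  { clear; induction M as [|M IH]; [reflexivity|]; rewrite tech5, IH; ring. }
  rewrite Cmod_mult, Cmod_R, Rabs_pos_eq by apply h0.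
  apply Rmult_le_compat_l with (r := e (S M)) in H1; [lra|apply h0].
Qed.

(** * Coefficients of functions subordinate to [frak_q s] *)

(** The mean value theorem along the ray from [0] to [z], applied to the
    component of [E] in the direction of [E z]. *)
Lemma vanishes_primitive (E E' : C -> C) (k : nat) (d : R) :
  0 < d -> (forall z, Cmod z < d -> is_cderive E z (E' z)) -> E 0%C = 0%C ->
  vanishes k E' -> vanishes (S k) E.
Proof.
intros hd hE hE0 [K [d' [hK [hd' H]]]]; exists K, (Rmin d d').
split; [exact hK|split; [apply Rmin_pos; assumption|]]; intros z hz.
pose proof (Rmin_l d d'); pose proof (Rmin_r d d').
(* [phi 1] is the square of the modulus of [E z]. *)
set (c := Cconj (E z)).
set (phi := fun t : R => Re (c * E (t * z))%C).
set (phi' := fun t : R => Re (c * (E' (t * z) * z))%C).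
assert (hsmall : forall t, 0 <= t <= 1 -> Cmod (t * z) <= Cmod z).
{ intros t ht; rewrite Cmod_mult, Cmod_R, Rabs_pos_eq by lra.
  rewrite <- (Rmult_1_l (Cmod z)) at 2; apply Rmult_le_compat_r; [apply Cmod_ge_0|lra]. }
assert (hder : forall t, 0 <= t <= 1 -> derivable_pt_lim phi t (phi' t)).
{ intros t ht eps heps; specialize (hsmall t ht).
  pose proof (Cmod_ge_0 c); pose proof (Cmod_ge_0 z).
  assert (hcz : 0 <= Cmod c * Cmod z) by (apply Rmult_le_pos; assumption).
  set (e := eps / (Cmod c * Cmod z + 1)).
  assert (he : 0 < e) by (apply Rdiv_lt_0_compat; lra).
  destruct (proj1 (is_cderive_eps _ _ _) (hE (t * z)%C ltac:(lra)) e he) as [del [hdel Hd]].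
  assert (hdel' : 0 < del / (Cmod z + 1)) by (apply Rdiv_lt_0_compat; lra).
  exists (mkposreal _ hdel'); intros h hh0 hh; simpl in hh.
  assert (hw : ((t + h)%R * z - t * z)%C = (h * z)%C) by (rewrite RtoC_plus; ring).
  assert (hhz : Cmod (h * z) = Rabs h * Cmod z) by (rewrite Cmod_mult, Cmod_R; reflexivity).
  pose proof (Rabs_pos_lt h hh0) as hpos.
  specialize (Hd ((t + h)%R * z)%C); rewrite hw, hhz in Hd.
  assert (hlt : Rabs h * Cmod z < del).
  { apply Rle_lt_trans with (Rabs h * (Cmod z + 1)); [apply Rmult_le_compat_l; lra|].
    apply Rmult_lt_compat_r with (r := Cmod z + 1) in hh; [|lra].
    replace (del / (Cmod z + 1) * (Cmod z + 1)) with del in hh by (field; lra); exact hh. }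
  specialize (Hd hlt).
  replace ((phi (t + h) - phi t) / h - phi' t)
    with (Re (c * (E ((t + h)%R * z) - E (t * z) - E' (t * z) * (h * z)))%C / h).
  - unfold Rdiv; rewrite Rabs_mult, Rabs_inv.
    apply Rmult_lt_reg_r with (Rabs h); [exact hpos|].
    rewrite Rmult_assoc, Rinv_l, Rmult_1_r by lra.
    eapply Rle_lt_trans; [apply re_le_Cmod|]; rewrite Cmod_mult.
    apply Rle_lt_trans with (Cmod c * (e * (Rabs h * Cmod z))); [apply Rmult_le_compat_l; assumption|].
    replace (Cmod c * (e * (Rabs h * Cmod z))) with (e * (Cmod c * Cmod z) * Rabs h) by ring.
    apply Rmult_lt_compat_r; [exact hpos|].
    apply Rlt_le_trans with (e * (Cmod c * Cmod z + 1)); [apply Rmult_lt_compat_l; lra|].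
    right; unfold e; field; lra.
  - unfold phi, phi'; clear - hh0.
    destruct c, z, (E _), (E _), (E' _); unfold Re, Cmult, Cminus, Cplus, Copp, RtoC; simpl; field; exact hh0. }
destruct (MVT_cor2 phi phi' 0 1 Rlt_0_1 hder) as [xi [hxi hxi1]].
assert (h1 : phi 1 = Cmod (E z) * Cmod (E z)).
{ unfold phi, c; rewrite Cmult_1_l, (Cmult_comm (Cconj _)), Cmult_conj_circle; reflexivity. }
assert (h0 : phi 0 = 0).
{ unfold phi; rewrite Cmult_0_l, hE0, Cmult_0_r; reflexivity. }
rewrite h1, h0 in hxi.
assert (hb : phi' xi <= Cmod (E z) * (K * Cmod z ^ k * Cmod z)).
{ unfold phi'; eapply Rle_trans; [apply Rle_abs|].
  eapply Rle_trans; [apply re_le_Cmod|]; rewrite !Cmod_mult; unfold c; rewrite Cmod_conj.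
  apply Rmult_le_compat_l; [apply Cmod_ge_0|]; apply Rmult_le_compat_r; [apply Cmod_ge_0|].
  specialize (hsmall xi ltac:(lra)).
  eapply Rle_trans; [apply H; lra|]; apply Rmult_le_compat_l; [exact hK|].
  apply pow_incr; split; [apply Cmod_ge_0|exact hsmall]. }
destruct (Req_dec (Cmod (E z)) 0) as [e0|e0].
- rewrite e0; apply Rmult_le_pos; [exact hK|apply pow_le, Cmod_ge_0].
- pose proof (Cmod_ge_0 (E z)).
  apply Rmult_le_reg_l with (Cmod (E z)); [lra|]; simpl pow; lra.
Qed.

(** The Taylor coefficients of [frak_q s] at the origin. *)
Definition binom_coef (s : R) (m : nat) : R := pochhammer s m / INR (fact m).

Lemma INR_fact_pos (m : nat) : 0 < INR (fact m).
Proof. apply lt_0_INR, lt_O_fact. Qed.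

Lemma binom_coef_S (s : R) (m : nat) :
  INR (S m) * binom_coef s (S m) = (s + INR m) * binom_coef s m.
Proof.
unfold binom_coef; rewrite fact_simpl, mult_INR; simpl pochhammer.
pose proof (INR_fact_pos m); assert (INR (S m) <> 0) by (apply not_0_INR; lia).
field; lra.
Qed.

Lemma binom_coef_0 (s : R) : binom_coef s 0 = 1.
Proof. unfold binom_coef; simpl; field. Qed.

Lemma binom_coef_nonneg (s : R) (m : nat) : 0 < s -> 0 <= binom_coef s m.
Proof.
intros hs; apply Rmult_le_pos; [|left; apply Rinv_0_lt_compat, INR_fact_pos].
induction m as [|m IH]; simpl; [lra|]; pose proof (pos_INR m); apply Rmult_le_pos; lra.
Qed.

(** [frak_q s] satisfies [(1 - w) y' = s y]; the partial sums satisfy it up to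
    one monomial of top degree. *)
Lemma is_cderive_binom_partial (s : R) (k : nat) (w : C) :
  exists l, is_cderive (fun w => Csum (fun j => binom_coef s j * w ^ j) k)%C w l /\
    ((1 - w) * l = s * Csum (fun j => binom_coef s j * w ^ j) k
      - ((s + INR k) * binom_coef s k)%R * w ^ k)%C.
Proof.
induction k as [|k [l [hl El]]].
- exists (RtoC 0); split.
  + apply (is_cderive_ext_ball (fun _ => RtoC (binom_coef s 0)) _ _ _ 1 Rlt_0_1);
      [|apply is_cderive_const].
    intros v _; rewrite Csum_O; simpl; ring.
  + rewrite Csum_O; simpl INR; rewrite Rplus_0_r, RtoC_mult; simpl; ring.
- exists (l + binom_coef s (S k) * (INR (S k) * w ^ k))%C; split.
  + apply (is_cderive_ext_ball (fun v => Csum (fun j => binom_coef s j * v ^ j) k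
        + binom_coef s (S k) * v ^ S k)%C _ _ _ 1 Rlt_0_1);
      [intros v _; symmetry; apply Csum_S|].
    apply is_cderive_plus; [exact hl|].
    eapply is_cderive_eq.
    * apply is_cderive_mult; [apply is_cderive_const|].
      apply (is_cderive_pow (fun v => v) (S k)), is_cderive_id.
    * cbv beta; simpl pred; ring.
  + rewrite Cmult_plus_distr_l, El, Csum_S, <- (binom_coef_S s k).
    rewrite !RtoC_mult, RtoC_plus, S_INR, RtoC_plus, Cpow_S; ring.
Qed.

(** The quotient of the partial sum by [frak_q s] has a derivative that is
    [O (w ^ k)], because both satisfy the same differential equation up to
    that order; hence it differs from [1] by [O (w ^ (k + 1))]. *)
Lemma frak_q_taylor (s : R) (k : nat) :
  taylor k (fun j => RtoC (binom_coef s j)) (frak_q s).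
Proof.
set (T := fun w => Csum (fun j => binom_coef s j * w ^ j)%C k).
set (g := fun w => (/ ((1 - w) * frak_q s w))%C).
set (cst := RtoC ((s + INR k) * binom_coef s k)).
assert (hg : forall w, Cmod w < 1 -> exists l, is_cderive g w l).
{ intros w hw; eexists; apply is_cderive_inv.
  - apply is_cderive_mult; [apply is_cderive_minus; [apply is_cderive_const|apply is_cderive_id]|].
    apply is_cderive_frak_q, hw.
  - apply Cmult_neq_0; [apply one_minus_disk_neq_0, hw|apply frak_q_neq_0]. }
assert (hE : vanishes (S k) (fun w => T w / frak_q s w - 1)%C).
{ apply (vanishes_primitive _ (fun w => - cst * g w * w ^ k)%C k 1 Rlt_0_1).
  - intros w hw; pose proof (one_minus_disk_neq_0 w hw) as h1; pose proof (frak_q_neq_0 s w) as h2.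
    destruct (is_cderive_binom_partial s k w) as [l [hl El]].
    eapply is_cderive_eq.
    + apply is_cderive_minus; [|apply is_cderive_const].
      apply is_cderive_mult; [exact hl|].
      apply is_cderive_inv; [apply is_cderive_frak_q, hw|exact h2].
    + fold (T w) in *; fold cst in El.
      transitivity (((1 - w) * l - s * T w) * g w)%C.
      * unfold g; field; split; assumption.
      * rewrite El; ring.
  - unfold T; rewrite frak_q_0.
    replace (Csum (fun j => binom_coef s j * 0 ^ j)%C k) with (RtoC 1); [field; intros F; injection F; lra|].
    induction k as [|k' IH]; [rewrite Csum_O, binom_coef_0; simpl; ring|].
    rewrite Csum_S, <- IH; simpl; ring.
  - destruct (hg (RtoC 0)) as [l hl]; [rewrite Cmod_0; lra|].
    apply (vanishes_mult 0 k); [|apply vanishes_pow].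
    apply vanishes_scal, (vanishes_O _ l hl). }
apply (vanishes_ext _ (fun w => - (1) * frak_q s w * (T w / frak_q s w - 1))%C).
- intros w; fold (T w); field; apply frak_q_neq_0.
- apply (vanishes_mult 0 (S k)); [|exact hE].
  apply vanishes_scal.
  refine (vanishes_O _ _ (is_cderive_frak_q s (RtoC 0) _)); unfold in_disk; rewrite Cmod_0; lra.
Qed.

Lemma vanishes_comp (k : nat) (E om : C -> C) :
  vanishes k E -> vanishes 1 om -> vanishes k (fun z => E (om z)).
Proof.
intros [K [d [hK [hd H]]]] [L [d' [hL [hd' H']]]].
exists (K * L ^ k), (Rmin d' (d / (L + 1))).
split; [apply Rmult_le_pos; [exact hK|apply pow_le, hL]|split].
{ apply Rmin_pos; [exact hd'|apply Rdiv_lt_0_compat; lra]. }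
intros z hz; pose proof (Rmin_l d' (d / (L + 1))); pose proof (Rmin_r d' (d / (L + 1))).
specialize (H' z ltac:(lra)); rewrite pow_1 in H'; pose proof (Cmod_ge_0 z).
assert (h : Cmod (om z) < d).
{ eapply Rle_lt_trans; [exact H'|].
  apply Rle_lt_trans with ((L + 1) * Cmod z); [apply Rmult_le_compat_r; lra|].
  apply Rlt_le_trans with ((L + 1) * (d / (L + 1))); [apply Rmult_lt_compat_l; lra|].
  right; field; lra. }
eapply Rle_trans; [apply H, h|].
rewrite Rmult_assoc, <- Rpow_mult_distr; apply Rmult_le_compat_l; [exact hK|].
apply pow_incr; split; [apply Cmod_ge_0|exact H'].
Qed.

Section Rogosinski.

Variables (s : R) (om : C -> C).
Hypotheses (hs0 : 0 < s) (hs1 : s <= 1).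
Hypotheses (hom : holomorphic_on_ball 1 om) (hom0 : om 0%C = 0%C)
  (hom1 : forall z, Cmod z < 1 -> Cmod (om z) < 1).

Lemma holomorphic_frak_q_comp : holomorphic_on_ball 1 (fun z => frak_q s (om z)).
Proof.
intros z hz; destruct (hom z hz) as [l hl]; eexists.
exact (is_cderive_comp (frak_q s) om z _ l (is_cderive_frak_q s _ (hom1 z hz)) hl).
Qed.

(** The bound that Rogosinski's theorem gives for a convex majorant.  The
    coefficient is a sum of [binom_coef s (j + 1) * tau j], where [tau j]
    belongs to [om ^ (j + 1)].  The [tau j] are coefficients of a polynomial
    bounded by [1] on the circle, and the weights [binom_coef s (j + 1)] are
    convex and decreasing because [s <= 1]; the first of them is [s]. *)
Lemma frak_q_coef_le (k : nat) (b : C) :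
  is_coef 1 (fun z => frak_q s (om z) - 1)%C (S k) b -> Cmod b <= s.
Proof.
intros hb.
assert (hpow : forall j, holomorphic_on_ball 1 (fun z => om z ^ j)%C)
  by (intros; apply holomorphic_pow, hom).
assert (htau : exists tau, forall j, is_coef 1 (fun z => om z ^ S j)%C (S k) (tau j)).
{ apply (functional_choice (fun j t => is_coef 1 (fun z => om z ^ S j)%C (S k) t)).
  intros j; apply ex_coef; [lra|apply hpow]. }
destruct htau as [tau htau].
assert (E : b = Csum (fun j => binom_coef s (S j) * tau j)%C k).
{ apply (is_coef_unique 1 (fun z => frak_q s (om z) - 1)%C (S k)); [lra|exact hb|].
  apply (is_coef_ext 1 (fun z =>
    (frak_q s (om z) - Csum (fun j => binom_coef s j * om z ^ j) (S k))
    + Csum (fun j => binom_coef s (S j) * om z ^ S j) k)%C).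
  { intros z _; change (S k) with (1 + k)%nat; rewrite (Csum_split _ 0 k).
    rewrite Csum_O, binom_coef_0; simpl Cpow at 1.
    replace (Csum (fun j => binom_coef s (1 + j) * om z ^ (1 + j))%C k)
      with (Csum (fun j => binom_coef s (S j) * om z ^ S j)%C k) by reflexivity.
    ring. }
  replace (Csum (fun j => binom_coef s (S j) * tau j)%C k)
    with (0 + Csum (fun j => binom_coef s (S j) * tau j) k)%C by ring.
  apply is_coef_plus.
  - apply is_coef_vanishes.
    + apply holomorphic_minus; [exact holomorphic_frak_q_comp|].
      apply (holomorphic_sum 1 (fun j z => binom_coef s j * om z ^ j)%C); intros j.
      apply holomorphic_mult; [apply holomorphic_const|apply hpow].
    + apply (vanishes_comp (S (S k)) (fun w => frak_q s w - Csum (fun j => binom_coef s j * w ^ j) (S k))%C om);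
        [exact (frak_q_taylor s (S k))|apply om_vanishes; assumption].
  - apply (is_coef_sum 1 (fun j z => binom_coef s (S j) * om z ^ S j)%C).
    intros j _; apply is_coef_scal, htau. }
rewrite E; apply Rle_trans with (binom_coef s 1); [|right; unfold binom_coef; simpl; field].
(* The differences are nonnegative and decreasing, being products of such factors. *)
assert (hd : forall j, binom_coef s j - binom_coef s (S j) = binom_coef s j * ((1 - s) / INR (S j))).
{ intros j; assert (hj : 0 < INR (S j)) by (apply lt_0_INR; lia).
  pose proof (binom_coef_S s j) as B.
  replace (binom_coef s (S j)) with ((s + INR j) * binom_coef s j / INR (S j))
    by (rewrite <- B; field; lra).
  rewrite S_INR in *; field; lra. }
assert (hq : forall j, 0 <= (1 - s) / INR (S j)).
{ intros j; apply Rmult_le_pos; [lra|left; apply Rinv_0_lt_compat, lt_0_INR; lia]. }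
assert (hdec : forall j, binom_coef s (S j) <= binom_coef s j).
{ intros j; specialize (hd j); specialize (hq j); pose proof (binom_coef_nonneg s j hs0) as hn.
  pose proof (Rmult_le_pos _ _ hn hq); lra. }
apply (convex_weights_bound (fun j => binom_coef s (S j)) tau k).
- intros j; apply binom_coef_nonneg, hs0.
- intros j; apply hdec.
- intros j; rewrite !hd; apply Rmult_le_compat; [apply binom_coef_nonneg, hs0|apply hq|apply hdec|].
  apply Rmult_le_compat_l; [lra|]; apply Rinv_le_contravar; [apply lt_0_INR; lia|apply le_INR; lia].
- intros x hx; apply (power_coefs_bound om hom hom0 hom1 k tau x htau hx).
Qed.

End Rogosinski.

(** * The recursion for the coefficients *)

Lemma Cmod_Csum_le (u : nat -> C) (v : nat -> R) (n : nat) :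
  (forall j, (j <= n)%nat -> Cmod (u j) <= v j) -> Cmod (Csum u n) <= sum_f_R0 v n.
Proof.
induction n as [|n IH]; intros H; [rewrite Csum_O; apply H; lia|].
rewrite Csum_S, tech5; eapply Rle_trans; [apply Cmod_triangle|].
apply Rplus_le_compat; [apply IH; intros; apply H|apply H]; lia.
Qed.

(** The [binom_coef s k] solve the extremal recursion with equality. *)
Lemma sum_binom_coef (s : R) (k : nat) :
  s * sum_f_R0 (binom_coef s) k = INR (S k) * binom_coef s (S k).
Proof.
induction k as [|k IH].
- rewrite binom_coef_S; simpl; ring.
- rewrite tech5, Rmult_plus_distr_l, IH, (binom_coef_S s (S k)); ring.
Qed.

Lemma coef_bound_of_recursion (s : R) (c b : nat -> C) :
  0 < s -> c O = 1%C -> (forall i, Cmod (b (S i)) <= s) ->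
  (forall k, INR (S k) * c (S k) = Csum (fun j => c j * b (S k - j)%nat) k)%C ->
  forall k, Cmod (c k) <= binom_coef s k.
Proof.
intros hs hc0 hb hrec.
assert (K : forall k j, (j <= k)%nat -> Cmod (c j) <= binom_coef s j).
{ induction k as [|k IH]; intros j hj.
  - replace j with O by lia; rewrite hc0, Cmod_1, binom_coef_0; lra.
  - destruct (Nat.eq_dec j (S k)) as [->|hne]; [|apply IH; lia].
    assert (hk : 0 < INR (S k)) by (apply lt_0_INR; lia).
    apply Rmult_le_reg_l with (INR (S k)); [exact hk|].
    rewrite <- sum_binom_coef.
    replace (INR (S k) * Cmod (c (S k))) with (Cmod (INR (S k) * c (S k)))
      by (rewrite Cmod_mult, Cmod_R, Rabs_pos_eq; lra).
    rewrite hrec, scal_sum; apply Cmod_Csum_le; intros i hi.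
    rewrite Cmod_mult; apply Rmult_le_compat; try apply Cmod_ge_0; [apply IH, hi|].
    replace (S k - i)%nat with (S (k - i)) by lia; apply hb. }
intros k; apply (K k); lia.
Qed.

Lemma taylor_0_neq_0 (c : nat -> C) (g : C -> C) :
  taylor 0 c g -> c O = 1%C -> exists d, 0 < d /\ forall z, Cmod z < d -> g z <> 0%C.
Proof.
intros [K [d [hK [hd H]]]] hc.
exists (Rmin d (/ (K + 1))); split.
{ apply Rmin_pos; [exact hd|apply Rinv_0_lt_compat; lra]. }
intros z hz E; pose proof (Rmin_l d (/ (K + 1))); pose proof (Rmin_r d (/ (K + 1))).
specialize (H z ltac:(lra)); rewrite Csum_O, E, hc in H; simpl Cpow in H; rewrite pow_1 in H.
replace (0 - 1 * 1)%C with (- (1))%C in H by ring; rewrite Cmod_m1 in H.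
pose proof (Cmod_ge_0 z).
assert ((K + 1) * Cmod z < 1); [|lra].
replace 1 with ((K + 1) * / (K + 1)) at 2 by (field; lra).
apply Rmult_lt_compat_l; lra.
Qed.

(** Compare coefficients of [z ^ (k + 1)] in [(p - 1) * f' = z * f''].  The
    identity is known near the origin only, where [f'] has no zero.  Replacing
    [f'] and [z * f''] by their Taylor polynomials changes it by a term of
    order [k + 2] and gives functions holomorphic in the whole disk, to which
    Cauchy coefficients apply. *)
Lemma convexity_recursion (f p : C -> C) (a b : nat -> C) :
  expands a f -> a 1%nat = 1%C -> holomorphic_on_ball 1 p -> p 0%C = 1%C ->
  (forall z, Cmod z < 1 -> (1 + z * C_derive (C_derive f) z / C_derive f z)%C = p z) ->
  (forall i, is_coef 1 (fun z => p z - 1)%C i (b i)) ->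
  forall k, (INR (S k) * derivative_coefs a (S k) = Csum (fun j => derivative_coefs a j * b (S k - j)%nat) k)%C.
Proof.
intros ha ha1 hp hp0 heq hb k.
destruct (expands_derive a f ha) as [hg _].
destruct (expands_derive _ _ hg) as [hg1 _].
set (c := derivative_coefs a) in *; set (g := C_derive f) in *; set (g1 := C_derive g) in *.
assert (hc0 : c O = 1%C) by (unfold c, derivative_coefs; rewrite ha1; simpl; ring).
set (p1 := fun z => (p z - 1)%C).
assert (hp1 : holomorphic_on_ball 1 p1) by (apply holomorphic_minus; [exact hp|apply holomorphic_const]).
destruct (hp1 (RtoC 0)) as [l hl]; [rewrite Cmod_0; lra|].
assert (vp1 : vanishes 1 p1) by (apply (vanishes_1 p1 l hl); unfold p1; rewrite hp0; ring).
assert (hb0 : b O = 0%C).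
{ apply (is_coef_unique 1 p1 O); [lra|apply hb|apply is_coef_vanishes; assumption]. }
set (G := fun z => Csum (fun j => c j * z ^ j)%C (S k)).
set (ZG := fun z => Csum (fun j => INR j * c j * z ^ j)%C (S k)).
assert (van : vanishes (S (S k)) (fun z => p1 z * G z - ZG z)%C).
{ destruct (taylor_0_neq_0 c g (expands_taylor _ _ 0 hg) hc0) as [d [hd hne]].
  apply (vanishes_ext_ball _ (fun z => z * (g1 z - Csum (fun j => derivative_coefs c j * z ^ j) k)
    - p1 z * (g z - G z))%C _ (Rmin d 1)).
  - apply Rmin_pos; lra.
  - intros z hz; pose proof (Rmin_l d 1); pose proof (Rmin_r d 1).
    specialize (hne z ltac:(lra)).
    assert (E : (p1 z * g z = z * g1 z)%C).
    { unfold p1; rewrite <- (heq z) by lra; field; exact hne. }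
    assert (EZ : ZG z = (z * Csum (fun j => derivative_coefs c j * z ^ j) k)%C).
    { unfold ZG; change (S k) with (1 + k)%nat; rewrite (Csum_split _ 0 k), Csum_O, <- Csum_Cmult_l.
      simpl INR at 1; replace (RtoC 0 * c O * z ^ 0)%C with (RtoC 0) by ring.
      rewrite Cplus_0_l; apply Csum_ext; intros i _; unfold derivative_coefs.
      change (1 + i)%nat with (S i); rewrite Cpow_S; ring. }
    rewrite EZ; transitivity (z * g1 z - z * Csum (fun j => derivative_coefs c j * z ^ j) k - p1 z * g z + p1 z * G z)%C;
      [ring|rewrite E; ring].
  - apply vanishes_minus.
    + apply (vanishes_mult 1 (S k) (fun z => z)); [|exact (expands_taylor _ _ k hg1)].
      apply (vanishes_ext 1 (fun z => z ^ 1)%C); [intros; ring|apply vanishes_pow].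
    + apply (vanishes_mult 0 (S (S k)) p1); [exact (vanishes_O p1 l hl)|exact (expands_taylor _ _ (S k) hg)]. }
assert (hG : holomorphic_on_ball 1 G) by apply holomorphic_poly.
assert (hZG : holomorphic_on_ball 1 ZG) by apply (holomorphic_poly 1 (fun j => INR j * c j)%C).
assert (c1 : is_coef 1 (fun z => p1 z * G z)%C (S k) (Csum (fun j => c j * b (S k - j)%nat)%C (S k))).
{ apply (is_coef_ext 1 (fun z => Csum (fun j => c j * (z ^ j * p1 z)) (S k))%C).
  - intros z _; unfold G; rewrite <- Csum_Cmult_l; apply Csum_ext; intros; ring.
  - apply (is_coef_sum 1 (fun j z => c j * (z ^ j * p1 z))%C); intros j hj.
    apply is_coef_scal, is_coef_shift; [exact hj|apply hb]. }
assert (c2 : is_coef 1 ZG (S k) (INR (S k) * c (S k))%C).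
{ apply (is_coef_taylor 1 ZG (fun j => INR j * c j)%C); [exact hZG|].
  apply (taylor_poly (fun j => INR j * c j)%C); lia. }
assert (E := is_coef_unique 1 _ (S k) _ _ Rlt_0_1 (is_coef_minus 1 _ _ _ _ _ c1 c2)
  (is_coef_vanishes 1 _ (S k) (holomorphic_minus _ _ _ (holomorphic_mult _ _ _ hp1 hG) hZG) van)).
rewrite Csum_S, Nat.sub_diag, hb0 in E.
match type of E with (?x + _ - ?y = _)%C => replace y with (x - (x + c (S k) * 0 - y))%C by ring end.
rewrite E; ring.
Qed.

Theorem theorem3p3 (s : R) (f : C -> C) (a : nat -> C)
    (hs0 : 0 < s) (hs1 : s <= 1)
    (hfa : normalized_expansion f a)
    (hf : class_CV_hpl s f)
    (n : nat) (hn : (2 <= n)%nat) :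
  Cmod (a n) <= pochhammer s (n - 1) / INR (fact n).
Proof.
destruct hf as [_ [om [hom [hom1 [hom0 heq]]]]].
pose proof (holomorphic_frak_q_comp s om hom hom1) as hp.
assert (hb : exists b, forall i, is_coef 1 (fun z => frak_q s (om z) - 1)%C i (b i)).
{ apply (functional_choice (fun i t => is_coef 1 (fun z => frak_q s (om z) - 1)%C i t)).
  intros i; apply ex_coef; [lra|].
  apply holomorphic_minus; [exact hp|apply holomorphic_const]. }
destruct hb as [b hb].
destruct n as [|n]; [lia|].
assert (H : Cmod (derivative_coefs a n) <= binom_coef s n).
{ apply (coef_bound_of_recursion s (derivative_coefs a) b hs0).
  - unfold derivative_coefs; rewrite (proj1 (proj2 hfa)); simpl; ring.
  - intros i; exact (frak_q_coef_le s om hs0 hs1 hom hom0 hom1 i _ (hb (S i))).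
  - apply (convexity_recursion f (fun z => frak_q s (om z))).
    + apply normalized_expands, hfa.
    + apply hfa.
    + exact hp.
    + rewrite hom0; apply frak_q_0.
    + exact heq.
    + exact hb. }
unfold derivative_coefs in H; rewrite Cmod_mult, Cmod_R, Rabs_pos_eq in H by apply pos_INR.
assert (hpos : 0 < INR (S n)) by (apply lt_0_INR; lia).
apply Rmult_le_reg_l with (INR (S n)); [exact hpos|].
replace (S n - 1)%nat with n by lia; rewrite fact_simpl, mult_INR.
eapply Rle_trans; [exact H|]; unfold binom_coef; pose proof (INR_fact_pos n).
right; field; lra.
Qed.
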